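(* Let $\varphi$ be a primitive, aperiodic substitution on a finite alphabet $\mathcal{A}$, let $\mathcal{T}_\varphi$ be its tiling space, let $K$ be the associated modified complex, and let $f:K\to K$ be the unique map with $f\circ p=p\circ\Phi$, where $\Phi:\mathcal{T}_\varphi\to\mathcal{T}_\varphi$ is the inflation and substitution homeomorphism and $p:\mathcal{T}_\varphi\to K$ is the projection (all defined in the context). Then the inverse limit space $\varprojlim f$ is homeomorphic to $\mathcal{T}_\varphi$.
   Context: **Substitutions.** A substitution on $\mathcal{A}=\{1,\dots,d\}$ is a map $\varphi:\mathcal{A}\to\mathcal{A}^*$ into finite nonempty words, extended to words by concatenation. Its transition matrix is $A=(a_{ij})$, where $a_{ij}$ is the number of occurrences of $i$ in $\varphi(j)$. $\varphi$ is primitive if for all sufficiently large $n$ every $\varphi^n(i)$ contains every letter $j$. A (finite or bi-infinite) word is allowed if each of its finite factors is a factor of some $\varphi^n(i)$, $i\in\mathcal{A}$, $n\in\mathbb{N}$; $\mathcal{L}$ is the set of finite allowed words. An allowed bi-infinite word $w=\dots w_{-1}.w_0w_1\dots$ is $\varphi$-periodic if $\varphi^m(w)=\dots\varphi^m(w_{-1}).\varphi^m(w_0)\dots=w$ for some $m\geq 1$. A primitive $\varphi$ is aperiodic if at least one (equivalently, each) $\varphi$-periodic bi-infinite word is not periodic under the shift. **Tiling space.** Let $\lambda$ be the Perron–Frobenius eigenvalue of $A$ and $(\omega_1,\dots,\omega_d)$ a positive left eigenvector for it. The prototiles are $P_i=[0,\omega_i]$, labelled by $i$ (so $P_i$ and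 $P_j$ are distinct for $i\neq j$ even if $\omega_i=\omega_j$). A tiling is a collection $T=\{T_i\}_{i\in\mathbb{Z}}$ of labelled translates of prototiles with union $\mathbb{R}$ such that $T_i\cap T_{i+1}$ is a singleton for each $i$, indexed left to right so that $0\in T_0\setminus T_1$. Its word $\underline{w}(T)=\dots w_{-1}w_0w_1\dots$ has $w_i=j$ iff $T_i$ is a translate of $P_j$. $\mathcal{T}_\varphi$ is the set of tilings whose word is allowed. Topology: $T,T'$ are close if, for some $\epsilon$ near $0$, $T$ and $T'+\epsilon$ are identical in a large neighborhood of $0$; this is compact and metrizable. **Inflation and substitution.** For a word $w=w_1\dots w_n$ let $\mathcal{P}_w+t=\{P_{w_1}+t,\ P_{w_2}+t+\omega_{w_1},\dots,P_{w_n}+t+\sum_{i<n}\omega_{w_i}\}$. Then $\Phi(\{P_{k_i}+t_i\}_{i\in\mathbb{Z}})=\bigcup_{i\in\mathbb{Z}}(\mathcal{P}_{\varphi(k_i)}+\lambda t_i)$. For $\varphi$ primitive and aperiodic, $\Phi:\mathcal{T}_\varphi\to\mathcal{T}_\varphi$ is known to be a homeomorphism. **The complex $K$.** Let $\epsilon=\min_{a}\omega_a/(2\lambda)>0$. For $a\in\mathcal{A}$ let $e_a=[\epsilon,\omega_a-\epsilon]\times\{a\}$ and for each two-letter word $ab\in\mathcal{L}$ let $e_{ab}=[-\epsilon,\epsilon]\times\{ab\}$. Let $K=[(\bigcup_a e_a)\cup(\bigcup_{ab\in\mathcal{L}}e_{ab})]/\sim$, where $\sim$ is generated by $(\omega_a-\epsilon,a)\sim(-\epsilon,ab)$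 and $(\epsilon,b)\sim(\epsilon,ab)$ for all $ab\in\mathcal{L}$. **The maps $p$ and $f$.** Given $T\in\mathcal{T}_\varphi$, let $t\in\mathbb{R}$ and $a,b,c\in\mathcal{A}$ be such that $T_0=[0,\omega_a]-t$ (of type $a$, containing $0$), $T_{-1}=[0,\omega_b]-t-\omega_b$ (of type $b$), and $T_1=[0,\omega_c]-t+\omega_a$ (of type $c$). Define $$p(T)=\begin{cases}[(t,a)]&\text{if }\epsilon\le t\le\omega_a-\epsilon,\\ [(t,ba)]&\text{if }0\le t\le\epsilon,\\ [(t-\omega_a,ac)]&\text{if }\omega_a-\epsilon\le t\le\omega_a.\end{cases}$$ The map $p:\mathcal{T}_\varphi\to K$ is a continuous surjection, and there is a unique map $f:K\to K$ with $f\circ p=p\circ\Phi$. **Inverse limit.** $\varprojlim f=\{(x_0,x_1,\dots)\in K^{\mathbb{N}}: f(x_i)=x_{i-1}\text{ for }i\ge1\}$ with the topology inherited from the product. *)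

(* Defs.v *)
From HB Require Import structures.
From mathcomp Require Import all_boot all_order all_algebra.
From mathcomp Require Import complex.
From mathcomp Require Import all_classical all_reals all_analysis.
From Stdlib Require Import Relations.Relation_Operators.

Set Implicit Arguments.
Unset Strict Implicit.
Unset Printing Implicit Defensive.

Import Order.TTheory GRing.Theory Num.Theory.
Import numFieldNormedType.Exports.

Local Open Scope classical_set_scope.
Local Open Scope ring_scope.

Section Substitutions.
Context {d : nat}.
Implicit Types (phi : 'I_d -> seq 'I_d) (u : seq 'I_d) (w : int -> 'I_d).

Definition subst_word phi u : seq 'I_d := flatten (map phi u).

Definition subst_pow phi (n : nat) (a : 'I_d) : seq 'I_d :=
  iter n (subst_word phi) [:: a].

Definition primitive_subst phi : Prop :=
  exists N : nat, forall n, (N <= n)%N -> forall i j, j \in subst_pow phi n i.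

Definition allowed phi u : Prop :=
  forall v, infix v u -> exists n i, infix v (subst_pow phi n i).

Definition factor w (k : int) (n : nat) : seq 'I_d :=
  [seq w (k + i%:Z) | i <- iota 0 n].

Definition biinf_allowed phi w : Prop :=
  forall k n, exists m i, infix (factor w k n) (subst_pow phi m i).

(* The word  ... phi(w_{-2}) phi(w_{-1}) . phi(w_0) phi(w_1) ...
   When phi takes nonempty values, its letters of index 0 .. n are read off
   phi(w_0) ... phi(w_n), and those of index -1 .. -(n+1) (where Negz n is
   -(n+1)) off phi(w_{-n-1}) ... phi(w_{-1}), from the right; the default value
   of nth is then never used. *)
Definition biinf_image phi w : int -> 'I_d := fun k =>
  match k with
  | Posz n => nth (w 0) (subst_word phi [seq w (Posz i) | i <- iota 0 n.+1]) n
  | Negz n => nth (w 0)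
      (rev (subst_word phi [seq w (Negz i) | i <- rev (iota 0 n.+1)])) n
  end.

Definition subst_periodic phi w : Prop :=
  exists2 m : nat, (0 < m)%N & biinf_image (subst_pow phi m) w = w.

Definition shift_periodic w : Prop :=
  exists2 n : nat, (0 < n)%N & forall k, w (k + n%:Z) = w k.

Definition aperiodic_subst phi : Prop :=
  exists w, [/\ biinf_allowed phi w, subst_periodic phi w & ~ shift_periodic w].

Definition transition_mx (R : realType) phi : 'M[R]_d :=
  \matrix_(i, j) (count_mem i (phi j))%:R.

End Substitutions.

(* The Perron-Frobenius eigenvalue: the real eigenvalue that bounds the modulus
   of every complex eigenvalue. *)
Definition perron_frobenius (R : realType) (n : nat) (M : 'M[R]_n) (lambda : R)
    : Prop :=
  eigenvalue M lambda /\
  forall z : R[i], eigenvalue (map_mx (real_complex R) M) z ->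
    `|z| <= real_complex R lambda.

Section Tiles.
Context {R : realType} {d : nat} (omega : 'rV[R]_d).

(* (x, a) is the translate P_a + x of the prototile P_a = [0, omega_a], with
   its label. *)
Definition ltile : Type := (R * 'I_d)%type.

Definition tile_supp (q : ltile) : set R :=
  [set y | q.1 <= y <= q.1 + omega ord0 q.2].

Definition translate (e : R) (C : set ltile) : set ltile :=
  [set (q.1 + e, q.2) | q in C].

(* The tiles of the collection that meet [-r, r]. *)
Definition around0 (r : R) (C : set ltile) : set ltile :=
  [set q | C q /\ exists2 y, `|y| <= r & tile_supp q y].

(* The collection P_u + x. *)
Fixpoint word_tiles (u : seq 'I_d) (x : R) : set ltile :=
  if u is a :: u' then [set (x, a)] `|` word_tiles u' (x + omega ord0 a)
  else set0.

(* The increasing indexing of the tiles by the integers with 0 in T_0 \ T_1 is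
   part of the data; it is determined by the collection of tiles. *)
Record tiling_space (phi : 'I_d -> seq 'I_d) := TilingSpace {
  lab : int -> 'I_d;
  pos : int -> R;
  tiling_cover : \bigcup_i tile_supp (pos i, lab i) = setT;
  tiling_consecutive : forall i, exists y,
    tile_supp (pos i, lab i) `&` tile_supp (pos (i + 1), lab (i + 1)) = [set y];
  tiling_left_to_right : {homo pos : i j / i < j};
  tiling_base : (tile_supp (pos 0, lab 0) `\` tile_supp (pos 1, lab 1)) 0;
  tiling_allowed : biinf_allowed phi lab }.

End Tiles.

Section TilingSpace.
Context {R : realType} {d : nat} (phi : 'I_d -> seq 'I_d) (omega : 'rV[R]_d).

Local Notation TS := (tiling_space omega phi).
Implicit Types T : TS.

Definition tiles T : set ltile := range (fun i => (pos T i, lab T i)).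

(* T and T' + e coincide on [- r^-1, r^-1] for some e with |e| < r. The topology
   below is the one in which the sets tiling_close r T, r > 0, form a base of
   neighbourhoods of T. *)
Definition tiling_close (r : R) T T' : Prop :=
  exists2 e : R, `|e| < r &
    around0 omega r^-1 (tiles T) = around0 omega r^-1 (translate e (tiles T')).

HB.instance Definition _ := gen_eqMixin TS.
HB.instance Definition _ := gen_choiceMixin TS.

Definition tiling_open (U : set TS) : Prop :=
  forall T, U T -> exists2 r : R, 0 < r & tiling_close r T `<=` U.

Lemma tiling_openT : tiling_open setT.
Proof. by move=> T _; exists 1. Qed.

Lemma around0_sub (r s : R) (C D : set ltile) : r <= s ->
  around0 omega s C = around0 omega s D -> around0 omega r C = around0 omega r D.
Proof.
move=> rs CD; apply/seteqP; split=> q [Cq [y yr qy]]; split; try by exists y.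
  have : around0 omega s C q by split=> //; exists y => //; exact: le_trans rs.
  by rewrite CD => -[].
have : around0 omega s D q by split=> //; exists y => //; exact: le_trans rs.
by rewrite -CD => -[].
Qed.

Lemma tiling_close_sub (r s : R) T : 0 < r -> r <= s ->
  tiling_close r T `<=` tiling_close s T.
Proof.
move=> r0 rs T' [e er TT']; exists e; first exact: lt_le_trans rs.
by apply: around0_sub TT'; rewrite lef_pV2// posrE (lt_le_trans r0).
Qed.

Lemma tiling_openI : setI_closed tiling_open.
Proof.
move=> U V oU oV T [/oU[r r0 rU] /oV[s s0 sV]].
have m0 : 0 < Order.min r s by rewrite lt_min r0 s0.
exists (Order.min r s) => // T' TT'; split.
  by apply: rU; apply: tiling_close_sub TT' => //; rewrite ge_min lexx.
by apply: sV; apply: tiling_close_sub TT' => //; rewrite ge_min lexx orbT.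
Qed.

Lemma tiling_open_bigU (I : Type) (U : I -> set TS) :
  (forall i, tiling_open (U i)) -> tiling_open (\bigcup_i U i).
Proof.
move=> oU T [i _ /oU[r r0 rU]]; exists r => // T' /rU UT'.
by exists i.
Qed.

HB.instance Definition _ :=
  isOpenTopological.Build TS tiling_openT tiling_openI tiling_open_bigU.

Definition inflate (lambda : R) T : set ltile :=
  \bigcup_i word_tiles omega (phi (lab T i)) (lambda * pos T i).

(* The tiling Phi(T) in the tiling space whose tiles are the collection
   inflate lambda T. There is exactly one when lambda is the
   Perron-Frobenius eigenvalue, omega a positive left eigenvector and phi takes
   nonempty values, so the default
   value T of xget is then never used. *)
Definition inflation (lambda : R) (T : TS) : TS :=
  xget T [set T' | tiles T' = inflate lambda T].

End TilingSpace.

Section Complex.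
Context {R : realType} {d : nat} (phi : 'I_d -> seq 'I_d) (omega : 'rV[R]_d)
  (lambda : R).

(* The infimum is a minimum, the set being finite. *)
Definition eps : R := inf (range (omega ord0)) / (2 * lambda).

Definition two_letter : set ('I_d * 'I_d) :=
  [set ab | allowed phi [:: ab.1; ab.2]].

Definition edge : Type := ('I_d + two_letter)%type.

HB.instance Definition _ := Choice.copy edge ('I_d + two_letter)%type.

Definition edge_dom (c : edge) : set R :=
  match c with
  | inl a => [set x | eps <= x <= omega ord0 a - eps]
  | inr _ => [set x | - eps <= x <= eps]
  end.

(* The disjoint union of the intervals e_a and e_ab. *)
Definition edges : Type := {c : edge & edge_dom c}.

HB.instance Definition _ := Topological.copy edges {c : edge & edge_dom c}.

Definition coord (q : edges) : R := set_val (tagged q).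

Inductive gluing (q q' : edges) : Prop :=
| gluing_left (ab : two_letter) of
    tag q = inl (val ab).1 & coord q = omega ord0 (val ab).1 - eps &
    tag q' = inr ab & coord q' = - eps
| gluing_right (ab : two_letter) of
    tag q = inl (val ab).2 & coord q = eps &
    tag q' = inr ab & coord q' = eps.

Definition glued (q q' : edges) : bool := `[< clos_refl_sym_trans _ gluing q q' >].

Lemma glued_refl : reflexive glued.
Proof. by move=> q; apply/asboolP; exact: rst_refl. Qed.

Lemma glued_sym : symmetric glued.
Proof. by move=> q q'; apply/asboolP/asboolP; exact: rst_sym. Qed.

Lemma glued_trans : transitive glued.
Proof.
move=> q q' q'' /asboolP qq' /asboolP q'q''; apply/asboolP.
exact: rst_trans q'q''.
Qed.

Definition glued_equiv : equiv_rel edges :=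
  EquivRel glued glued_refl glued_sym glued_trans.

Definition K : Type := quotient_topology {eq_quot glued_equiv}%qT.

HB.instance Definition _ :=
  Topological.copy K (quotient_topology {eq_quot glued_equiv}%qT).

Definition K_point (c : edge) (x : R) (cx : edge_dom c x) : K :=
  (\pi_{eq_quot glued_equiv} (existT _ c (SigSub (mem_set cx))))%qT.

End Complex.

Section Projection.
Context {R : realType} {d : nat} (phi : 'I_d -> seq 'I_d) (omega : 'rV[R]_d)
  (lambda : R).

Local Notation TS := (tiling_space omega phi).
Local Notation eps := (eps omega lambda).
Implicit Types T : TS.

(* The t with T_0 = [0, omega_a] - t. *)
Definition offset T : R := - pos T 0.

Lemma offset_itv T : 0 <= offset T <= omega ord0 (lab T 0).
Proof.
case: (tiling_base T) => /andP[/= p0 p1] _.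
by rewrite /offset oppr_ge0 p0 -subr_ge0 opprK addrC.
Qed.

Lemma two_letter_tiling T (k : int) : two_letter phi (lab T k, lab T (k + 1)).
Proof.
move=> v vk; have [n [i kn]] := tiling_allowed T k 2.
exists n, i; apply: infix_trans kn; move: vk.
by rewrite /factor /= addr0.
Qed.

Definition pair_at T (k : int) : two_letter phi :=
  SigSub (mem_set (@two_letter_tiling T k)).

Lemma offset_left T : 0 <= offset T <= eps ->
  edge_dom omega lambda (inr (pair_at T (-1))) (offset T).
Proof.
move=> /andP[t0 te].
by rewrite /= te andbT (le_trans _ t0)// oppr_le0 (le_trans t0).
Qed.

Lemma offset_right T :
  ~ (eps <= offset T <= omega ord0 (lab T 0) - eps) ->
  ~ (0 <= offset T <= eps) ->
  edge_dom omega lambda (inr (pair_at T 0)) (offset T - omega ord0 (lab T 0)).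
Proof.
have /andP[t0 tw] := offset_itv T.
rewrite t0 /= => /negP + /negP; rewrite -ltNge => + et.
rewrite (ltW et) /= -ltNge => wt; apply/andP; split.
  by rewrite lerBrDl ltW.
have e0 : 0 < eps.
  by move: (lt_le_trans wt tw); rewrite gtrDl oppr_lt0.
by rewrite lerBlDl (le_trans tw)// lerDl ltW.
Qed.

Definition tiling_proj T : K phi omega lambda :=
  match pselect (eps <= offset T <= omega ord0 (lab T 0) - eps) with
  | left mid => K_point (c := inl (lab T 0)) mid
  | right not_mid =>
      match pselect (0 <= offset T <= eps) with
      | left left_end => K_point (offset_left left_end)
      | right not_left => K_point (offset_right not_mid not_left)
      end
  end.

End Projection.

Definition inv_lim (X : topologicalType) (f : X -> X) : set {ptws nat -> X} :=
  [set x | forall i, f (x i.+1) = x i].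

Definition homeomorphic (X Y : topologicalType) : Prop :=
  exists (g : X -> Y) (h : Y -> X),
    [/\ continuous g, continuous h, cancel g h & cancel h g].

(* Main.v *)
Require Import Defs.
From mathcomp Require Import all_boot all_order all_algebra.
From mathcomp Require Import all_classical all_reals all_analysis.
From mathcomp Require Import zify ring lra.
From Stdlib Require Import Relations.Relation_Operators.

Set Implicit Arguments.
Unset Strict Implicit.
Unset Printing Implicit Defensive.

Import Order.TTheory GRing.Theory Num.Theory.
Import numFieldNormedType.Exports.

Local Open Scope classical_set_scope.
Local Open Scope ring_scope.

(* Points of the inverse limit of f are the sequences (p (Phi^-n T))_n. Since
   p S determines S on [-eps/2, eps/2], the n-th term determines T on
   [-lambda^n eps/2, lambda^n eps/2], which gives injectivity; surjectivity,
   and the continuity of the inverse, come from the compactness of the tiling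
   space and the fact that K is Hausdorff.

   Phi is surjective because its image is compact and, by recurrence, dense.
   For its injectivity, suppose Phi S = Phi S' and choose S_n, S'_n with
   Phi^n S_n = S and Phi^n S'_n = S'. By compactness there are n < m such that,
   on a large ball, S_n is S_m translated by g and S'_n is S'_m translated by g',
   where g and g' are small. Applying Phi^(m+1), the tiling Phi S agrees with its
   translate by lambda^(m+1) (g' - g) on a ball of radius much larger than that
   translation, so g = g' by aperiodicity. But Phi^m S_n = Phi^m S'_n, hence S and
   S' agree on a ball of radius comparable to lambda^m, where m is arbitrarily
   large. *)

(** * Words and the substitution *)

(** The intervals e_ab are what makes p determine a tiling near the origin. With the prototiles
    glued directly end to end, a point near a vertex would not tell which tile lies across it. Here
    a point of e_ab records both tiles at the vertex, and a point of e_a is at distance at least eps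
    from both ends of its tile. Inflating n times then multiplies the radius of what is known by
    lambda^n, and lambda > 1 because a primitive substitution on at least two letters lengthens
    tiles; aperiodicity excludes a single letter.

    In the injectivity of Phi, the ball and the translation both grow like lambda^(m+1), so
    aperiodicity is needed in a quantitative form whose constant does not depend on the scale
    ([patch_aperiodic]). The linear bound comes from primitivity: every pair of adjacent n-th level
    supertiles recurs within a distance proportional to lambda^n.

    Tilings are handled as sets of tiles, because translation and inflation act simply on sets but
    change the index of the tile at the origin. *)

Section Language.
Context {d : nat} (phi : 'I_d -> seq 'I_d).
Implicit Types (u v : seq 'I_d) (w : int -> 'I_d).

Definition lang u : Prop := exists n i, infix u (subst_pow phi n i).

Lemma lang_infix u v : infix u v -> lang v -> lang u.
Proof. by move=> uv [n [i vi]]; exists n, i; exact: infix_trans vi. Qed.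

Lemma allowedE u : allowed phi u <-> lang u.
Proof.
split=> [|lu v vu]; first by apply; exact: infix_refl.
exact: lang_infix lu.
Qed.

Lemma subst_word_cat u v :
  subst_word phi (u ++ v) = subst_word phi u ++ subst_word phi v.
Proof. by rewrite /subst_word map_cat flatten_cat. Qed.

Lemma subst_word1 a : subst_word phi [:: a] = phi a.
Proof. exact: cats0. Qed.

Lemma iter_subst_word_cat n u v : iter n (subst_word phi) (u ++ v) =
  iter n (subst_word phi) u ++ iter n (subst_word phi) v.
Proof. by elim: n => //= n ->; rewrite subst_word_cat. Qed.

Lemma iter_subst_word_infix n u v : infix u v ->
  infix (iter n (subst_word phi) u) (iter n (subst_word phi) v).
Proof.
move=> /infixP[s1 [s2 ->]]; rewrite !iter_subst_word_cat.
by rewrite infix_catl// prefix_infix// prefix_prefix.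
Qed.

Lemma iter_subst_wordE n u :
  iter n (subst_word phi) u = flatten (map (subst_pow phi n) u).
Proof.
elim: u => [|a u IH]; first by elim: n => //= n ->.
by rewrite -cat1s iter_subst_word_cat IH.
Qed.

Lemma subst_powD m n i :
  subst_pow phi (m + n) i = iter m (subst_word phi) (subst_pow phi n i).
Proof. by rewrite /subst_pow iterD. Qed.

Lemma lang_subst n u : lang u -> lang (iter n (subst_word phi) u).
Proof.
move=> [m [i ui]]; exists (n + m)%N, i.
by rewrite subst_powD iter_subst_word_infix.
Qed.

Lemma mem_infix_subst n i u : i \in u ->
  infix (subst_pow phi n i) (iter n (subst_word phi) u).
Proof.
move=> /path.splitPr[p1 p2]; apply: iter_subst_word_infix.
by rewrite infix_catl// prefix_infix//= eqxx prefix0s.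
Qed.

Context (phi_primitive : primitive_subst phi).

(** If [u] occurs in phi^m(i), write k = m + k' with k' large: the letter i occurs in phi^k'(j), and
    applying phi^m turns this occurrence into a copy of phi^m(i). *)
Lemma lang_recurrent u : lang u ->
  exists k0, forall k, (k0 <= k)%N -> forall j, infix u (subst_pow phi k j).
Proof.
case: phi_primitive => N primN [m [i ui]]; exists (m + N)%N => k km j.
have -> : k = (m + (k - m))%N by lia.
rewrite subst_powD; apply: infix_trans ui _; apply: mem_infix_subst.
by apply: primN; lia.
Qed.

End Language.

Lemma cat_eq_prefix (T : Type) (s1 s2 t1 t2 : seq T) :
  s1 ++ s2 = t1 ++ t2 -> (size s1 <= size t1)%N ->
  exists2 r, t1 = s1 ++ r & s2 = r ++ t2.
Proof.
elim: s1 t1 => [|a s1 IH] [|b t1] //=; first by exists [::].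
  by exists (b :: t1).
by move=> [-> e] /(IH _ e)[r -> ->]; exists r.
Qed.

(** * Lengths of words, and their growth under the substitution *)

Section Lengths.
Context {R : realType} {d : nat} (omega : 'rV[R]_d).
Hypothesis omega_pos : forall a, 0 < omega ord0 a.
Implicit Types (u v : seq 'I_d).

Definition wlen u : R := \sum_(a <- u) omega ord0 a.

Lemma wlen_cons a u : wlen (a :: u) = omega ord0 a + wlen u.
Proof. by rewrite /wlen big_cons. Qed.

Lemma wlen_nil : wlen [::] = 0.
Proof. by rewrite /wlen big_nil. Qed.

Lemma wlen1 a : wlen [:: a] = omega ord0 a.
Proof. by rewrite wlen_cons wlen_nil addr0. Qed.

Lemma wlen_cat u v : wlen (u ++ v) = wlen u + wlen v.
Proof. by rewrite /wlen big_cat. Qed.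

Lemma wlen_ge0 u : 0 <= wlen u.
Proof. by rewrite /wlen; apply: sumr_ge0 => a _; exact: ltW. Qed.

Lemma wlen_gt0 u : u != [::] -> 0 < wlen u.
Proof. by case: u => // a u _; rewrite wlen_cons ltr_pwDl ?wlen_ge0. Qed.

Lemma wlen_mem a u : a \in u -> omega ord0 a <= wlen u.
Proof.
elim: u => // c u IH; rewrite in_cons wlen_cons => /orP[/eqP ->|/IH h].
  by rewrite lerDl wlen_ge0.
by have := omega_pos c; lra.
Qed.

Lemma wlen_mem2 a b u : a \in u -> b \in u -> a != b -> omega ord0 a < wlen u.
Proof.
elim: u => // c u IH; rewrite !in_cons wlen_cons.
have c0 := omega_pos c.
move=> /orP[/eqP ->|au] /orP[/eqP ->|bu]; rewrite ?eqxx // => ab.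
- by have := wlen_mem bu; have := omega_pos b; lra.
- by have := wlen_mem au; lra.
- by have := IH au bu ab; lra.
Qed.

(** The block in which [v] starts accounts for at most B of its length, so at least B remains, which
    is enough to contain the whole next block. *)
Lemma infix_flatten_long (g : 'I_d -> seq 'I_d) (B : R) v y :
  0 < B -> (forall j, wlen (g j) <= B) -> B *+ 2 <= wlen v ->
  infix v (flatten (map g y)) -> exists j, infix (g j) v.
Proof.
move=> B0 gB vB; elim: y => [|c y IH].
  by rewrite infixs0 => /eqP v0; move: vB; rewrite v0 wlen_nil => H; exfalso; lra.
have flat_cons c' y' : flatten (map g (c' :: y')) = g c' ++ flatten (map g y') by [].
rewrite flat_cons => /infixP[s1 [s2 e]].
have [cs|sc] := leqP (size (g c)) (size s1).
  have [r _ e'] := cat_eq_prefix e cs.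
  by apply: IH; rewrite e'; exact: infix_infix.
have [t gc e'] := cat_eq_prefix (esym e) (ltnW sc).
have gcB : wlen s1 + wlen t <= B by rewrite -wlen_cat -gc.
have s10 := wlen_ge0 s1.
have [vt|tv] := leqP (size v) (size t).
  have [r tr _] := cat_eq_prefix e' vt.
  have r0 := wlen_ge0 r.
  by move: gcB; rewrite tr wlen_cat => gcB; exfalso; lra.
have [v' ev ef] := cat_eq_prefix (esym e') (ltnW tv).
have v'B : B <= wlen v' by move: vB; rewrite ev wlen_cat => v_; lra.
case: y ef {IH e e'} => [|c' y].
  by case: v' ev v'B => // ev; rewrite wlen_nil => H; exfalso; lra.
rewrite flat_cons => e; have [cv|vc] := leqP (size (g c')) (size v').
  have [r er _] := cat_eq_prefix e cv.
  by exists c'; rewrite ev er infix_catl// prefix_infix.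
have [r er _] := cat_eq_prefix (esym e) (ltnW vc).
have : r != [::].
  by apply/eqP => r0; move: vc; rewrite er r0 cats0 ltnn.
by move=> /wlen_gt0 r0; have := gB c'; rewrite er wlen_cat => cB; exfalso; lra.
Qed.

Section Eigen.
Context (phi : 'I_d -> seq 'I_d) (lambda : R).
Hypothesis omega_eigenvector : omega *m transition_mx R phi = lambda *: omega.

(** This is column j of the eigenvector equation, the letters of [phi j] being counted by type. *)
Lemma wlen_phi j : wlen (phi j) = lambda * omega ord0 j.
Proof.
have /matrixP/(_ ord0 j) := omega_eigenvector.
rewrite !mxE => <-.
under [RHS]eq_bigr do rewrite mxE.
rewrite /wlen; elim: (phi j) => [|a u IH].
  by rewrite big_nil big1// => i _; rewrite mulr0.
rewrite big_cons IH /= [in RHS](bigD1 a)//= eqxx natrD mulrDr mulr1 -addrA.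
congr (_ + _); rewrite (bigD1 a)//=; congr (_ + _); apply: eq_bigr => i ia.
by rewrite eq_sym (negbTE ia).
Qed.

Lemma wlen_subst u : wlen (subst_word phi u) = lambda * wlen u.
Proof.
elim: u => [|a u IH]; first by rewrite /subst_word /= wlen_nil mulr0.
by rewrite -[a :: u]cat1s subst_word_cat !wlen_cat IH mulrDr wlen_nil addr0 wlen_phi wlen1.
Qed.

Lemma wlen_iter n u : wlen (iter n (subst_word phi) u) = lambda ^+ n * wlen u.
Proof. by elim: n => [|n IH] /=; rewrite ?mul1r// wlen_subst IH exprS mulrA. Qed.

Lemma wlen_pow n i : wlen (subst_pow phi n i) = lambda ^+ n * omega ord0 i.
Proof. by rewrite wlen_iter wlen1. Qed.

(** For large N the word phi^N(j) contains j and another letter, so its length lambda^N omega_j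
    exceeds omega_j. *)
Lemma eigen_gt1 : primitive_subst phi -> (1 < d)%N -> 1 < lambda.
Proof.
move=> [N /(_ N (leqnn _)) primN] d1.
pose j := Ordinal (ltn_trans (ltn0Sn 0) d1); pose k := Ordinal d1.
have jk : j != k by [].
have : omega ord0 j < wlen (subst_pow phi N j).
  exact: wlen_mem2 (primN j j) (primN j k) jk.
rewrite wlen_pow -{1}[omega ord0 j]mul1r ltr_pM2r// => lamN.
have lam0 : 0 <= lambda.
  have := wlen_ge0 (phi j); rewrite wlen_phi pmulr_lge0//.
by rewrite ltNge; apply: contraTN lamN => lam1; rewrite -leNgt exprn_ile1.
Qed.

End Eigen.
End Lengths.

(** * Patches of tiles and their inflation *)

Section Patches.
Context {R : realType} {d : nat} (omega : 'rV[R]_d).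
Hypothesis omega_pos : forall a, 0 < omega ord0 a.
Implicit Types (u v : seq 'I_d) (q : @ltile R d) (C D : set (@ltile R d)).

Definition tile_covers q (y : R) : bool := q.1 <= y < q.1 + omega ord0 q.2.

Lemma covers_start q : tile_covers q q.1.
Proof. by rewrite /tile_covers lexx ltrDl omega_pos. Qed.

Lemma word_tiles_cat u v x : word_tiles omega (u ++ v) x =
  word_tiles omega u x `|` word_tiles omega v (x + wlen omega u).
Proof.
elim: u x => [|a u IH] x /=; first by rewrite wlen_nil addr0 set0U.
by rewrite IH setUA wlen_cons addrA.
Qed.

Lemma word_tiles_bounds u x q : word_tiles omega u x q ->
  x <= q.1 /\ q.1 + omega ord0 q.2 <= x + wlen omega u.
Proof.
elim: u x => [|a u IH] x //= [->|/IH[h1 h2]] /=; rewrite wlen_cons.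
  by have := wlen_ge0 omega_pos u; split; lra.
by have := omega_pos a; split; lra.
Qed.

Lemma word_tiles_cover u x y : x <= y < x + wlen omega u ->
  exists2 q, word_tiles omega u x q & tile_covers q y.
Proof.
elim: u x => [|a u IH] x; first by rewrite wlen_nil; lra.
rewrite wlen_cons => /andP[xy yx].
have [ya|ay] := ltP y (x + omega ord0 a).
  by exists (x, a); [left|rewrite /tile_covers /= xy ya].
have [|q uq qy] := IH (x + omega ord0 a); first by rewrite ay -addrA.
by exists q => //; right.
Qed.

Lemma word_tiles_uniq u x q q' y : word_tiles omega u x q ->
  word_tiles omega u x q' -> tile_covers q y -> tile_covers q' y -> q = q'.
Proof.
elim: u x => [|a u IH] x //= [->|uq] [->|uq'] //; last exact: IH uq uq'.
- have [/=] := word_tiles_bounds uq'; rewrite /tile_covers /= => h1 h2 /andP[h3 h4] /andP[h5 h6].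
  by exfalso; lra.
- have [/=] := word_tiles_bounds uq; rewrite /tile_covers /= => h1 h2 /andP[h3 h4] /andP[h5 h6].
  by exfalso; lra.
Qed.

Lemma word_tilesD u x e q :
  word_tiles omega u (x + e) q <-> word_tiles omega u x (q.1 - e, q.2).
Proof.
elim: u x => [|a u IH] x //=; rewrite addrAC; split=> [[->|/IH]|[[<- <-]|/IH]].
- by left => /=; rewrite addrK.
- by right.
- by left => /=; rewrite subrK -surjective_pairing.
- by right.
Qed.

Lemma word_tiles_infix u v : infix u v ->
  exists2 y, 0 <= y /\ y + wlen omega u <= wlen omega v &
    forall x, word_tiles omega u (x + y) `<=` word_tiles omega v x.
Proof.
move=> /infixP[s1 [s2 ->]]; exists (wlen omega s1).
  rewrite !wlen_cat.
  by have := wlen_ge0 omega_pos s1; have := wlen_ge0 omega_pos s2; split; lra.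
by move=> x q uq; rewrite !word_tiles_cat; right; left.
Qed.

Lemma translateE e C q : translate e C q <-> C (q.1 - e, q.2).
Proof.
split=> [[[x a] Cx <-]|Cq]; first by rewrite /= addrK.
by exists (q.1 - e, q.2) => //=; rewrite subrK; case: q Cq.
Qed.

Lemma translateD e e' C : translate e (translate e' C) = translate (e + e') C.
Proof.
apply/seteqP; split=> q; rewrite !translateE /=.
  by rewrite opprD addrA.
by rewrite opprD addrA.
Qed.

Lemma translate0 C : translate 0 C = C.
Proof. by apply/seteqP; split=> -[x a]; rewrite translateE /= subr0. Qed.

(** For r >= 0 the two inequalities say that the closed tile meets [-r, r], so this is equality of
    [around0]. Stated tile by tile, it composes and passes easily through translation and
    inflation. *)
Definition agree (r : R) C D :=
  forall q, q.1 <= r -> - r <= q.1 + omega ord0 q.2 -> C q <-> D q.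

Lemma agree_sym r C D : agree r C D -> agree r D C.
Proof. by move=> h q q1 q2; split=> /h; apply. Qed.

Lemma agree_trans r C D E : agree r C D -> agree r D E -> agree r C E.
Proof. by move=> h h' q q1 q2; split=> [/h /h'|/h' /h]; apply=> // ; apply. Qed.

Lemma agree_sub s r C D : s <= r -> agree r C D -> agree s C D.
Proof. by move=> rs h q q1 q2; apply: h; lra. Qed.

Lemma agree_translate r s e C D : `|e| + s <= r -> agree r C D ->
  agree s (translate e C) (translate e D).
Proof.
move=> es h q q1 q2; rewrite !translateE; apply: h => /=.
  by move: (ler_norm (- e)) es; rewrite normrN; lra.
by move: (ler_norm e) es; lra.
Qed.

Lemma around0E r C q : 0 <= r -> around0 omega r C q <->
  [/\ C q, q.1 <= r & - r <= q.1 + omega ord0 q.2].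
Proof.
move=> r0; split=> [[Cq [y]]|[Cq q1 q2]].
  by rewrite ler_norml /tile_supp /= => /andP[? ?] /andP[? ?]; split=> //; lra.
have qp := omega_pos q.2.
(* The left end of the intersection of the tile with [-r, r]. *)
split=> //; exists (Num.max (- r) q.1); rewrite /tile_supp /= ?ler_norml.
  by rewrite le_max lexx ge_max q1 /= andbT; lra.
by rewrite le_max lexx orbT ge_max q2 /=; lra.
Qed.

Lemma around0_agree r C D : 0 <= r ->
  around0 omega r C = around0 omega r D <-> agree r C D.
Proof.
move=> r0; split=> [h q q1 q2|h].
  split=> Cq.
    have : around0 omega r C q by apply/around0E.
    by rewrite h => /around0E-[].
  have : around0 omega r D q by apply/around0E.
  by rewrite -h => /around0E-[].
by apply/seteqP; split=> q /around0E-/(_ r0)[Cq q1 q2]; apply/around0E => //;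
  split=> //; apply/h.
Qed.

Lemma agree_eq C D : (forall r, 0 < r -> exists2 s, r <= s & agree s C D) -> C = D.
Proof.
move=> h; suff CD q : C q <-> D q by apply/seteqP; split=> q /CD.
have qp := omega_pos q.2.
have r0 : 0 < 1 + `|q.1| by rewrite ltr_pwDl.
have [s rs] := h _ r0; apply.
  by have := ler_norm q.1; lra.
by have := ler_norm (- q.1); rewrite normrN; lra.
Qed.

Context (phi : 'I_d -> seq 'I_d) (lambda : R).
Hypothesis lambda_gt1 : 1 < lambda.
Hypothesis omega_eigenvector : omega *m transition_mx R phi = lambda *: omega.

Let lambda_gt0 : 0 < lambda.
Proof. by move: lambda_gt1; lra. Qed.

(** Unlike [inflate], this applies to arbitrary collections, in particular to patches and to
    translates of tilings. *)
Definition infl C := \bigcup_(q in C) word_tiles omega (phi q.2) (lambda * q.1).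

Lemma infl_translate e C : infl (translate e C) = translate (lambda * e) (infl C).
Proof.
apply/seteqP; split=> q.
  move=> [p /translateE Cp pq]; apply/translateE; exists (p.1 - e, p.2) => //=.
  by apply/word_tilesD; rewrite -mulrDr subrK.
move=> /translateE[p Cp pq]; exists (p.1 + e, p.2).
  by apply/translateE; rewrite /= addrK; case: p Cp {pq}.
by rewrite /= mulrDr; apply/word_tilesD.
Qed.

Lemma iter_infl_translate n e C :
  iter n infl (translate e C) = translate (lambda ^+ n * e) (iter n infl C).
Proof.
elim: n => [|n IH] /=; first by rewrite mul1r.
by rewrite IH infl_translate exprS mulrA.
Qed.

Lemma infl_word_tiles u x : infl (word_tiles omega u x) =
  word_tiles omega (subst_word phi u) (lambda * x).
Proof.
rewrite /infl; elim: u x => [|a u IH] x; first by rewrite bigcup_set0.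
rewrite -[a :: u]cat1s subst_word_cat !word_tiles_cat bigcup_setU IH.
rewrite subst_word1 wlen1 (wlen_phi omega_eigenvector) mulrDr; congr (_ `|` _).
have -> : word_tiles omega [:: a] x = [set (x, a)] by exact: setU0.
by rewrite bigcup_set1; exact: esym (setU0 _).
Qed.

Lemma iter_infl_word_tiles n u x : iter n infl (word_tiles omega u x) =
  word_tiles omega (iter n (subst_word phi) u) (lambda ^+ n * x).
Proof.
elim: n => [|n IH]; first by rewrite /= mul1r.
by rewrite !iterS IH infl_word_tiles exprS mulrA.
Qed.

Lemma infl_sub C D : C `<=` D -> infl C `<=` infl D.
Proof. exact: bigcup_subset. Qed.

Lemma iter_infl_sub n C D : C `<=` D -> iter n infl C `<=` iter n infl D.
Proof. by move=> CD; elim: n => //= n; exact: infl_sub. Qed.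

(** The tiles born from [p] fill lambda times the support of [p]; if one of them meets the ball of
    radius lambda r, then [p] meets the ball of radius r. *)
Lemma agree_infl r C D : agree r C D -> agree (lambda * r) (infl C) (infl D).
Proof.
move=> h q q1 q2.
suff near p : word_tiles omega (phi p.2) (lambda * p.1) q -> C p <-> D p.
  by split=> -[p Cp pq]; exists p => //; apply/(near p).
move=> /word_tiles_bounds; rewrite (wlen_phi omega_eigenvector) => -[h1 h2]; apply: h.
  by rewrite -(ler_pM2l lambda_gt0); lra.
rewrite -(ler_pM2l lambda_gt0); lra.
Qed.

Lemma agree_iter_infl n r C D : agree r C D ->
  agree (lambda ^+ n * r) (iter n infl C) (iter n infl D).
Proof.
move=> h; elim: n => [|n IH]; first by rewrite mul1r.
by rewrite exprS -mulrA; exact: agree_infl.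
Qed.

End Patches.

(** * Tilings as sets of tiles *)

Section Geometry.
Context {R : realType} {d : nat} (omega : 'rV[R]_d) (phi : 'I_d -> seq 'I_d).
Hypothesis omega_pos : forall a, 0 < omega ord0 a.
Implicit Types (u v : seq 'I_d) (q : @ltile R d) (C D : set (@ltile R d)).

Local Notation covers := (tile_covers omega).

Definition tiles_disjoint C :=
  forall q q' y, C q -> C q' -> covers q y -> covers q' y -> q = q'.

(* Half-open supports, so that every real lies in exactly one tile. *)
Record geom C : Prop := Geom {
  geom_cover : forall y, exists2 q, C q & covers q y;
  geom_uniq : tiles_disjoint C;
  geom_lang : forall u x, word_tiles omega u x `<=` C -> lang phi u }.

Definition omin : R := inf (range (omega ord0)).

Lemma omin_le a : omin <= omega ord0 a.
Proof.
apply: ge_inf; last by exists a.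
by exists 0 => _ [b _ <-]; exact: ltW.
Qed.

(** The sum stands in for the maximum: only a common upper bound on the tile lengths matters. *)
Definition omax : R := \sum_a omega ord0 a.

Lemma le_omax a : omega ord0 a <= omax.
Proof.
rewrite /omax (bigD1 a)//= lerDl; apply: sumr_ge0 => b _; exact: ltW.
Qed.

Lemma omin_gt0 (a : 'I_d) : 0 < omin.
Proof.
case: (@Order.TotalTheory.arg_minP _ _ _ a xpredT (omega ord0)) => // i _ hi.
apply: (lt_le_trans (omega_pos i)); apply: lb_le_inf; first by exists (omega ord0 a); exists a.
by move=> _ [b _ <-]; exact: hi.
Qed.

Lemma wlen_takeS i u : wlen omega (take i.+1 u) <= wlen omega (take i u) + omax.
Proof.
elim: u i => [|a u IH] i; first by rewrite wlen_nil add0r sumr_ge0// => a _; exact: ltW.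
case: i => [|i] /=; first by rewrite take0 wlen1 wlen_nil add0r le_omax.
by rewrite !wlen_cons -addrA lerD2l IH.
Qed.

Lemma omax_gt0 (a : 'I_d) : 0 < omax.
Proof. exact: lt_le_trans (omega_pos a) (le_omax a). Qed.

(** Drop the tiles of [v] that end before [x]. The first remaining one covers [x], so by
    disjointness it is the first tile of [u]; from there both chains run through the same tiles. *)
Lemma chain_in_chain C u v x y : tiles_disjoint C -> word_tiles omega u x `<=` C ->
  word_tiles omega v y `<=` C -> y <= x -> x + wlen omega u <= y + wlen omega v ->
  infix u v.
Proof.
move=> gC; have [->|] := eqVneq u [::]; first by rewrite infix0s.
move=> u0 uC; elim: v y => [|c v IH] y vC yx.
  by rewrite wlen_nil; have := wlen_gt0 omega_pos u0; lra.
move=> uv; have [ycx|xyc] := leP (y + omega ord0 c) x.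
  apply: infix_trans (infix_cons v c); apply: IH ycx _.
    by move=> q vq; apply: vC; right.
  by rewrite -addrA -wlen_cons.
apply: prefixW.
have xy : x = y.
  case: u u0 uC uv {IH} => // a u _ uC _.
  suff [->] : (x, a) = (y, c) by [].
  apply: (gC _ _ x).
  - by apply: uC; left.
  - by apply: vC; left.
  - exact: (covers_start omega_pos (x, a)).
  - by rewrite /tile_covers /= yx.
rewrite {}xy in uC uv * => {IH yx xyc x u0}.
elim: u (c :: v) y uC vC uv => [|a u IH] [|b w] y uC wC; rewrite ?prefix0s//.
  by rewrite wlen_nil; have := wlen_gt0 omega_pos (u := a :: u) erefl; lra.
move=> uw; have [ab] : (y, a) = (y, b).
  apply: (gC _ _ y).
  - by apply: uC; left.
  - by apply: wC; left.
  - exact: (covers_start omega_pos (y, a)).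
  - exact: (covers_start omega_pos (y, b)).
rewrite /= ab eqxx /=; apply: IH (y + omega ord0 b) _ _ _.
- by move=> q uq; apply: uC; right; rewrite ab.
- by move=> q wq; apply: wC; right.
- by move: uw; rewrite ab !wlen_cons; lra.
Qed.

Section OneTiling.
Context (C : set (@ltile R d)).
Hypothesis gC : geom C.

Lemma geom_next q : C q -> exists b, C (q.1 + omega ord0 q.2, b).
Proof.
move=> Cq; have [[x b] Cp /andP[/= p1 p2]] := geom_cover gC (q.1 + omega ord0 q.2).
exists b; suff -> : q.1 + omega ord0 q.2 = x by [].
apply/eqP; rewrite eq_le p1 andbT leNgt; apply/negP => xq.
have qp := omega_pos q.2.
have e : q = (x, b).
  apply: (geom_uniq gC (y := Num.max q.1 x)) => //; rewrite /tile_covers /=.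
    by rewrite le_max lexx /= gt_max; apply/andP; split; lra.
  by rewrite le_max lexx orbT /= gt_max; apply/andP; split; lra.
by move: p2; rewrite e /= ltxx.
Qed.

(** Take the tile covering the point [omin / 2] to the left of [q]. If it ended before [q.1], its
    successor would be long enough to cover [q.1]; if it ended after, it would cover [q.1] itself.
    Either way a tile other than [q] would cover the start of [q]. *)
Lemma geom_prev q : C q -> exists b, C (q.1 - omega ord0 b, b).
Proof.
move=> Cq; have m0 := omin_gt0 q.2.
have [[x b] Cp /andP[/= p1 p2]] := geom_cover gC (q.1 - omin / 2).
have [c Cc] := geom_next Cp; rewrite /= in Cc.
have xq : x + omega ord0 b = q.1.
  have [h|h|//] := ltgtP (x + omega ord0 b) q.1.
    have e : (x + omega ord0 b, c) = q.
      apply: (geom_uniq gC (y := q.1)) => //; last exact: covers_start.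
      by rewrite /tile_covers /= (ltW h) /=; have := omin_le c; lra.
    by move: h; rewrite -e /= ltxx.
  have e : (x, b) = q.
    apply: (geom_uniq gC (y := q.1)) => //; last exact: covers_start.
    by rewrite /tile_covers /=; apply/andP; split; lra.
  by move: p1; rewrite -e /=; lra.
by exists b; rewrite -xq addrK.
Qed.

Lemma geom_chain y r : 0 <= r -> exists u x, [/\ word_tiles omega u x `<=` C,
  x <= y, y + r < x + wlen omega u, y - omax <= x &
  x + wlen omega u <= y + r + omax].
Proof.
move=> r0; have [q0 Cq0 /andP[h1 h2]] := geom_cover gC y.
have m0 := omin_gt0 q0.2.
suff chain n : exists u, [/\ word_tiles omega u q0.1 `<=` C, u != [::] &
    q0.1 + omega ord0 q0.2 + n%:R * omin <= q0.1 + wlen omega u].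
  have [u [uC _ hu]] := chain (Num.truncn (r / omin)).+1.
  have ex_i : exists i, y + r < q0.1 + wlen omega (take i u).
    exists (size u); rewrite take_size; apply: lt_le_trans hu.
    have : r / omin < (Num.truncn (r / omin)).+1%:R by exact: Num.Theory.truncnS_gt.
    by rewrite ltr_pdivrMr//; lra.
  case: (ex_minnP ex_i) => -[|i]; first by rewrite take0 wlen_nil; lra.
  (* Take the shortest prefix that passes y + r: without its last tile it does not, so it overshoots
     by at most [omax]. *)
  move=> hi imin; exists (take i.+1 u), q0.1.
  have uiC : word_tiles omega (take i.+1 u) q0.1 `<=` C.
    by apply: subset_trans uC; rewrite -{2}(cat_take_drop i.+1 u) word_tiles_cat => q; left.
  have h3 := le_omax q0.2; split=> //; first lra.
  apply: le_trans (_ : q0.1 + (wlen omega (take i u) + omax) <= _).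
    by rewrite lerD2l wlen_takeS.
  rewrite addrA lerD2r leNgt; apply/negP => /imin.
  by rewrite ltnn.
elim: n => [|n [u [uC u0 hu]]].
  exists [:: q0.2]; split=> //; last by rewrite wlen1 mul0r addr0.
  by move=> q [->|//]; rewrite -surjective_pairing.
have [q uq qy] : exists2 q, word_tiles omega u q0.1 q & q.1 + omega ord0 q.2 = q0.1 + wlen omega u.
  case/lastP: u u0 {uC hu} => // u a _.
  exists (q0.1 + wlen omega u, a); rewrite -cats1 ?word_tiles_cat /=; first by right; left.
  by rewrite wlen_cat wlen1 addrA.
have [b Cb] := geom_next (uC _ uq); rewrite qy in Cb.
exists (rcons u b); rewrite -cats1; split.
- by move=> p; rewrite word_tiles_cat => -[/uC//|[->|//]].
- by case: (u).
- by rewrite wlen_cat wlen1 -natr1 mulrDl mul1r; have := omin_le b; lra.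
Qed.

Lemma geom_translate e : geom (translate e C).
Proof.
split.
- move=> y; have [q Cq /andP[q1 q2]] := geom_cover gC (y - e).
  exists (q.1 + e, q.2).
    by apply/translateE; rewrite /= addrK -surjective_pairing.
  by rewrite /tile_covers /=; apply/andP; split; lra.
- move=> [x a] [x' a'] y /translateE /= Cq /translateE /= Cq' /andP[/= q1 q2] /andP[/= q3 q4].
  have [xx' ->] : (x - e, a) = (x' - e, a').
    by apply: (geom_uniq gC (y := y - e)) => //; rewrite /tile_covers /=; apply/andP; split; lra.
  by rewrite -(subrK e x) xx' subrK.
- move=> u x ux; apply: (geom_lang gC (x := x - e)) => q /word_tilesD h.
  have /ux /translateE : word_tiles omega u x (q.1 + e, q.2).
    by move: h; rewrite opprK.
  by rewrite /= addrK -surjective_pairing.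
Qed.

End OneTiling.

Context (lambda : R).
Hypothesis lambda_gt1 : 1 < lambda.
Hypothesis omega_eigenvector : omega *m transition_mx R phi = lambda *: omega.

Let lambda_gt0 : 0 < lambda.
Proof. by move: lambda_gt1; lra. Qed.

Local Notation infl := (infl omega phi lambda).

Lemma covers_parent a x q y : word_tiles omega (phi a) (lambda * x) q ->
  covers q y -> covers (x, a) (y / lambda).
Proof.
move=> /(word_tiles_bounds omega_pos); rewrite (wlen_phi omega_eigenvector).
move=> [h1 h2] /andP[h3 h4]; rewrite /tile_covers /= ler_pdivlMr// ltr_pdivrMr//.
by apply/andP; split; lra.
Qed.

Lemma covers_child a x y : covers (x, a) (y / lambda) ->
  exists2 q, word_tiles omega (phi a) (lambda * x) q & covers q y.
Proof.
rewrite /tile_covers /= ler_pdivlMr// ltr_pdivrMr// => /andP[h1 h2].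
apply: word_tiles_cover; rewrite (wlen_phi omega_eigenvector).
by apply/andP; split; lra.
Qed.

Lemma geom_infl C : geom C -> geom (infl C).
Proof.
move=> gC; have guniq q q' y : infl C q -> infl C q' -> covers q y -> covers q' y -> q = q'.
  move=> [p Cp pq] [p' Cp' pq'] qy q'y.
  have e : p = p'.
    apply: (geom_uniq gC (y := y / lambda)) => //.
      by rewrite (surjective_pairing p); exact: covers_parent pq qy.
    by rewrite (surjective_pairing p'); exact: covers_parent pq' q'y.
  by rewrite -e in pq'; exact: (word_tiles_uniq omega_pos pq pq' qy q'y).
split=> //.
  move=> y; have [[x a] Cp /covers_child[q aq qy]] := geom_cover gC (y / lambda).
  by exists q => //; exists (x, a).
move=> u x uC.
have u0 := wlen_ge0 omega_pos u.
(* A chain of [C] over the interval of [u] scaled down by lambda; its image under the substitution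
   covers that of [u], so [u] is a factor of an allowed word. *)
have [|v [z [vC zx xz _ _]]] := geom_chain gC (x / lambda) (r := wlen omega u / lambda).
  by rewrite divr_ge0// ltW.
have lv : lang phi (subst_word phi v) by apply: (@lang_subst _ phi 1); exact: geom_lang vC.
have vI : word_tiles omega (subst_word phi v) (lambda * z) `<=` infl C.
  by rewrite -(infl_word_tiles omega_eigenvector); exact: infl_sub.
apply: lang_infix lv; apply: (chain_in_chain guniq uC vI).
  by rewrite mulrC -ler_pdivlMr.
rewrite (wlen_subst omega_eigenvector) -mulrDr mulrC -ler_pdivrMr// mulrDl.
exact: ltW.
Qed.

End Geometry.

(** * Passage between sets of tiles and indexed tilings *)

Section Indexing.
Context {R : realType} {d : nat} (omega : 'rV[R]_d) (phi : 'I_d -> seq 'I_d).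
Hypothesis omega_pos : forall a, 0 < omega ord0 a.
Implicit Types (u v : seq 'I_d) (q : @ltile R d) (C D : set (@ltile R d)).

Local Notation covers := (tile_covers omega).
Local Notation omin := (omin omega).

Lemma factor_cons (w : int -> 'I_d) k n :
  Defs.factor w k n.+1 = w k :: Defs.factor w (k + 1) n.
Proof.
rewrite /Defs.factor /= addr0; congr (_ :: _); rewrite -[1%N]addn0 iotaDl -map_comp.
by apply: eq_map => i /=; rewrite PoszD addrA.
Qed.

Section Sequence.
Context (w : int -> 'I_d) (x : int -> R).
Hypothesis x_next : forall i : int, x (i + 1) = x i + omega ord0 (w i).

Let m0 : 0 < omin.
Proof. exact: omin_gt0 (w 0). Qed.

Definition seq_tiles : set (@ltile R d) := range (fun i => (x i, w i)).

Lemma seq_posD i (n : nat) : x i + n%:R * omin <= x (i + n%:Z).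
Proof.
elim: n => [|n IH]; first by rewrite mul0r !addr0.
rewrite -natr1 -addn1 PoszD addrA x_next mulrDl mul1r.
by have := omin_le omega_pos (w (i + n%:Z)); lra.
Qed.

Lemma seq_pos_next (i j : int) : (i < j)%R -> x i + omega ord0 (w i) <= x j.
Proof.
rewrite -lezD1 -x_next => ij.
have [n ->] : exists n : nat, j = i + 1 + n%:Z by exists (absz (j - (i + 1))%R); lia.
by apply: le_trans (seq_posD _ n); rewrite lerDl mulr_ge0// ltW.
Qed.

Lemma seq_pos_lt : {homo x : i j / i < j}.
Proof. by move=> i j /seq_pos_next; have := omega_pos (w i); lra. Qed.

Lemma seq_disjoint i j y : covers (x i, w i) y -> covers (x j, w j) y -> i = j.
Proof.
move=> /andP[/= h1 h2] /andP[/= h3 h4].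
by have [/seq_pos_next|/seq_pos_next|//] := ltgtP i j => h; exfalso; lra.
Qed.

Lemma seq_cover y : exists i, covers (x i, w i) y.
Proof.
have grow z : exists n : nat, z < n%:R * omin.
  exists (Num.truncn (z / omin)).+1; rewrite -ltr_pdivrMr//.
  exact: Num.Theory.truncnS_gt.
have [n hn] := grow (x 0 - y).
pose b := - n%:Z; have xb : x b <= y.
  by have := seq_posD b n; rewrite addNr; lra.
have ex_k : exists k : nat, y < x (b + k%:Z).
  by have [k hk] := grow (y - x b); exists k; have := seq_posD b k; lra.
have := ex_minnP ex_k; case=> -[|k]; first by rewrite addr0; lra.
move=> hk kmin; exists (b + k%:Z).
rewrite /tile_covers /= -x_next -addrA -PoszD addn1 hk andbT leNgt.
by apply/negP => /kmin; rewrite ltnn.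
Qed.

Lemma word_tiles_factor k n : word_tiles omega (Defs.factor w k n) (x k) `<=` seq_tiles.
Proof.
elim: n k => [|n IH] k; first by [].
rewrite factor_cons => q [->|]; first by exists k.
by rewrite -x_next; exact: IH.
Qed.

Lemma word_tiles_seq u z : word_tiles omega u z `<=` seq_tiles ->
  exists k, u = Defs.factor w k (size u).
Proof.
case: u => [_|a u h]; first by exists 0.
have [k _ [kz ka]] : seq_tiles (z, a) by apply: h; left.
exists k; elim: u a k z kz ka h => [|b u IH] a k z kz ka h.
  by rewrite factor_cons ka.
rewrite factor_cons ka; congr (_ :: _).
have zk : z + omega ord0 a = x (k + 1) by rewrite x_next kz ka.
have [j _ [jz jb]] : seq_tiles (z + omega ord0 a, b) by apply: h; right; left.
have jk : j = k + 1.
  by apply: (seq_disjoint (y := x j));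
    [exact: (covers_start omega_pos (x j, w j))|
     rewrite jz zk; exact: (covers_start omega_pos (x (k + 1), w (k + 1)))].
rewrite jk in jz jb.
by apply: IH jz jb _ => q uq; apply: h; right.
Qed.

Lemma geom_seq : biinf_allowed phi w <-> geom omega phi seq_tiles.
Proof.
split=> [aw|g k n].
  split.
  - by move=> y; have [i iy] := seq_cover y; exists (x i, w i) => //; exists i.
  - by move=> _ _ y [i _ <-] [j _ <-] iy jy; rewrite (seq_disjoint iy jy).
  - by move=> u z /word_tiles_seq[k ->]; exact: aw.
by apply: (geom_lang g); exact: word_tiles_factor.
Qed.

Lemma tiling_of_seq : biinf_allowed phi w -> x 0 <= 0 < x 1 ->
  exists2 T : tiling_space omega phi, lab T = w & pos T = x.
Proof.
move=> aw /andP[x0 x1].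
have cov : \bigcup_i tile_supp omega (x i, w i) = setT.
  apply/seteqP; split=> // y _; have [i /andP[i1 i2]] := seq_cover y.
  by exists i => //; rewrite /tile_supp /= i1 ltW.
have cons i : exists y,
    tile_supp omega (x i, w i) `&` tile_supp omega (x (i + 1), w (i + 1)) = [set y].
  have p0 := omega_pos (w i); have p1 := omega_pos (w (i + 1)).
  exists (x (i + 1)); apply/seteqP; split=> y; rewrite /tile_supp /= x_next.
    by move=> [/andP[_ h1] /andP[h2 _]]; apply/eqP; rewrite eq_le h1 h2.
  by move=> ->; split; apply/andP; split; lra.
have base : (tile_supp omega (x 0, w 0) `\` tile_supp omega (x 1, w 1)) 0.
  split; rewrite /tile_supp /=.
    by rewrite x0 /=; rewrite -x_next add0r ltW.
  by move=> /andP[h _]; lra.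
by exists (@TilingSpace R d omega phi w x cov cons seq_pos_lt base aw).
Qed.

End Sequence.

Section Tilings.
Local Notation TS := (tiling_space omega phi).
Implicit Types T : TS.

(** The intersection of the two tiles runs from [pos T (i + 1)] to the smaller of their right ends.
    As it is a single point and tile i + 1 has positive length, the smaller right end is that of
    tile i. *)
Lemma pos_next T i : pos T (i + 1) = pos T i + omega ord0 (lab T i).
Proof.
have [y h] := tiling_consecutive T i.
have lt1 : pos T i < pos T (i + 1) by apply: (tiling_left_to_right T); rewrite ltrDl.
have lt2 := omega_pos (lab T (i + 1)).
have : [set y] y by [].
rewrite -h => -[/andP[/= h1 h2] /andP[/= h3 h4]].
have inE z : pos T (i + 1) <= z -> z <= pos T i + omega ord0 (lab T i) ->
    z <= pos T (i + 1) + omega ord0 (lab T (i + 1)) -> z = y.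
  move=> z1 z2 z3; have : (tile_supp omega (pos T i, lab T i) `&`
      tile_supp omega (pos T (i + 1), lab T (i + 1))) z.
    by rewrite /tile_supp /=; split; apply/andP; split; lra.
  by rewrite h.
have e1 : pos T (i + 1) = y by apply: inE; lra.
apply/eqP; rewrite eq_le e1 h2 /= leNgt; apply/negP => lt3.
have : Num.min (pos T i + omega ord0 (lab T i)) (pos T (i + 1) + omega ord0 (lab T (i + 1))) = y.
  by apply: inE; rewrite ?ge_min ?le_min ?lexx ?orbT//; apply/andP; split; lra.
have lt4 : pos T (i + 1) < Num.min (pos T i + omega ord0 (lab T i))
    (pos T (i + 1) + omega ord0 (lab T (i + 1))).
  by rewrite lt_min; apply/andP; split; lra.
by move=> me; move: lt4; rewrite me e1 ltxx.
Qed.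

Lemma pos0 T : pos T 0 <= 0 < pos T 1.
Proof.
have [/andP[/= h1 h2]] := tiling_base T.
have := pos_next T 0; rewrite add0r /tile_supp /= => e h.
rewrite h1 /= ltNge; apply/negP => h3; apply: h; rewrite h3 /=.
by have := omega_pos (lab T 1); lra.
Qed.

Lemma geom_tiles T : geom omega phi (tiles T).
Proof. by apply/(geom_seq (@pos_next T)); exact: tiling_allowed. Qed.

Lemma tiling_eq T T' : lab T = lab T' -> pos T = pos T' -> T = T'.
Proof.
case: T T' => l p c1 c2 c3 c4 c5 [l' p' c1' c2' c3' c4' c5'] /= ll pp.
by subst l' p'; congr TilingSpace; exact: Prop_irrelevance.
Qed.

(** Index 0 belongs to the tile covering the origin, and each tile determines its two neighbours:
    the right one covers the next vertex, the left one the point [omin / 2] before the tile. *)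
Lemma tiles_inj T T' : tiles T = tiles T' -> T = T'.
Proof.
move=> TT'; have disj := geom_uniq (geom_tiles T').
have tileT i : tiles T (pos T i, lab T i) by exists i.
have tileT' i : tiles T' (pos T' i, lab T' i) by exists i.
have e0 : (pos T 0, lab T 0) = (pos T' 0, lab T' 0).
  apply: (disj _ _ 0) => //; first by rewrite -TT'.
    by rewrite /tile_covers /= -pos_next add0r pos0.
  by rewrite /tile_covers /= -pos_next add0r pos0.
have next i : (pos T i, lab T i) = (pos T' i, lab T' i) ->
    (pos T (i + 1), lab T (i + 1)) = (pos T' (i + 1), lab T' (i + 1)).
  move=> [ep el]; apply: (disj _ _ (pos T (i + 1))) => //; first by rewrite -TT'.
    exact: (covers_start omega_pos (pos T (i + 1), _)).
  rewrite !pos_next ep el -pos_next.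
  exact: (covers_start omega_pos (pos T' (i + 1), _)).
have prev i : (pos T (i + 1), lab T (i + 1)) = (pos T' (i + 1), lab T' (i + 1)) ->
    (pos T i, lab T i) = (pos T' i, lab T' i).
  move=> [ep el]; have m := omin_gt0 omega_pos (lab T 0).
  have h1 := omin_le omega_pos (lab T i); have h2 := omin_le omega_pos (lab T' i).
  apply: (disj _ _ (pos T (i + 1) - omin / 2)) => //; first by rewrite -TT'.
    by rewrite /tile_covers /= pos_next; apply/andP; split; lra.
  by rewrite ep /tile_covers /= pos_next; apply/andP; split; lra.
have all i : (pos T i, lab T i) = (pos T' i, lab T' i).
  elim/int_rec: i => [//|n IH|n IH].
    by rewrite -addn1 PoszD; exact: next.
  by apply: prev; rewrite -addn1 PoszD opprD addrNK.
by apply: tiling_eq; apply/funext => i; case: (all i).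
Qed.

Lemma geom_tiling C : geom omega phi C -> exists T, tiles T = C.
Proof.
move=> gC; have [q0 Cq0 q00] := geom_cover gC 0.
have /choice[nx nxP] : forall q, exists b, C q -> C (q.1 + omega ord0 q.2, b).
  move=> q; have [/(geom_next omega_pos gC)[b Cb]|nC] := pselect (C q); first by exists b.
  by exists q.2.
have /choice[pv pvP] : forall q, exists b, C q -> C (q.1 - omega ord0 b, b).
  move=> q; have [/(geom_prev omega_pos gC)[b Cb]|nC] := pselect (C q); first by exists b.
  by exists q.2.
pose fwd q := (q.1 + omega ord0 q.2, nx q).
pose bwd q := (q.1 - omega ord0 (pv q), pv q).
(* [Negz n] is -(n+1), hence n + 1 backward steps. *)
pose t (i : int) := match i with Posz n => iter n fwd q0 | Negz n => iter n.+1 bwd q0 end.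
have Ct i : C (t i).
  case: i => n; rewrite /t; first by elim: n => //= n; exact: nxP.
  by elim: n.+1 => //= k; exact: pvP.
have t_next i : (t (i + 1)).1 = (t i).1 + omega ord0 (t i).2.
  case: i => n; first by rewrite -PoszD addn1.
  have -> : Negz n + 1 = - n%:Z by rewrite NegzE; lia.
  by case: n => [|n]; rewrite -?NegzE /= subrK.
(* The chain already covers the line, so by uniqueness no tile of [C] is missed. *)
have tC : seq_tiles (fun i => (t i).2) (fun i => (t i).1) = C.
  apply/seteqP; split=> [_ [i _ <-]|q Cq]; first by rewrite -surjective_pairing.
  have [i iq] := seq_cover t_next q.1.
  exists i => //; apply: (geom_uniq gC _ _ iq) => //.
    by rewrite -surjective_pairing.
  exact: covers_start.
have [||T Tl Tp] := tiling_of_seq t_next.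
- by apply/(geom_seq t_next); rewrite tC.
- by have := t_next 0; rewrite add0r => ->; exact: q00.
by exists T; rewrite -tC /seq_tiles /tiles Tl Tp.
Qed.

End Tilings.
End Indexing.

(** * The topology of the tiling space *)

Section TilingTopology.
Context {R : realType} {d : nat} (omega : 'rV[R]_d) (phi : 'I_d -> seq 'I_d).
Hypothesis omega_pos : forall a, 0 < omega ord0 a.

Local Notation TS := (tiling_space omega phi).
Local Notation agree := (agree omega).
Local Notation covers := (tile_covers omega).
Local Notation omin := (omin omega).
Local Notation omax := (omax omega).
Implicit Types T : TS.

Lemma tiling_closeP (r : R) T T' : 0 < r -> tiling_close r T T' <->
  exists2 e, `|e| < r & agree r^-1 (tiles T) (translate e (tiles T')).
Proof.
move=> r0; have ri : 0 <= r^-1 by rewrite invr_ge0 ltW.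
by split=> -[e er h]; exists e => //; apply/around0_agree.
Qed.

Lemma tiling_close_refl (r : R) T : 0 < r -> tiling_close r T T.
Proof. by move=> r0; exists 0; rewrite ?normr0// translate0. Qed.

Lemma tiling_close_open (r : R) T : 0 < r -> open (tiling_close r T : set TS).
Proof.
move=> r0; suff : tiling_open (tiling_close r T : set TS) by [].
move=> T' /(tiling_closeP _ _ r0)[e er hT].
(* The shifts add up, which leaves r - |e| for the second one; translating by e costs less than r of
   radius, so the second agreement must reach r^-1 + r. *)
pose s := Num.min (r - `|e|) (r^-1 + r)^-1.
have s0 : 0 < s.
  by rewrite lt_min subr_gt0 er invr_gt0 addr_gt0// invr_gt0.
exists s => // T'' /(tiling_closeP _ _ s0)[e' es hT'].
have sr : s <= r - `|e| by rewrite ge_min lexx.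
have si : r^-1 + r <= s^-1.
  rewrite -[leLHS]invrK lef_pV2 ?posrE// ?invr_gt0 ?addr_gt0 ?invr_gt0//.
  by rewrite ge_min lexx orbT.
apply/tiling_closeP => //; exists (e + e').
  by apply: le_lt_trans (ler_normD _ _) _; lra.
apply: agree_trans hT _; rewrite -translateD.
by apply: agree_translate hT'; lra.
Qed.

Lemma nbhs_tilingP T (A : set TS) :
  nbhs T A <-> exists2 r : R, 0 < r & tiling_close r T `<=` A.
Proof.
split=> [|[r r0 rA]].
  rewrite nbhsE => -[B [oB BT] BA].
  have /(_ T BT)[r r0 rB] : tiling_open B by exact: oB.
  by exists r => //; exact: subset_trans BA.
apply: filterS rA _; apply: open_nbhs_nbhs; split.
  exact: tiling_close_open.
exact: tiling_close_refl.
Qed.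

(** If T and T' cannot be separated, then for each tile of T some arbitrarily small translate of it
    is a tile of T'. The tiles of T' have lengths bounded below, so the translation must be 0. *)
Lemma tiling_space_hausdorff : hausdorff_space TS.
Proof.
suff sub T T' : cluster (nbhs T) T' -> tiles T `<=` tiles T'.
  move=> T T' TT'; apply: (tiles_inj omega_pos); apply/seteqP; split.
    exact: sub.
  by apply: sub => A B nA nB; rewrite setIC; exact: TT'.
move=> TT' q Tq; have gT' := geom_tiles omega_pos T'.
have m0 := omin_gt0 omega_pos q.2.
have [q' Tq' q'q] := geom_cover gT' q.1.
have near_eq (r : R) : 0 < r -> exists2 e, `|e| < r & tiles T' (q.1 + e, q.2).
  move=> r0; pose s := Num.min (r / 2) (`|q.1| + 1 + r)^-1.
  have ps : 0 < `|q.1| + 1 + r by have := normr_ge0 q.1; lra.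
  have s0 : 0 < s by rewrite lt_min divr_gt0// invr_gt0.
  have sr : s <= r / 2 by rewrite ge_min lexx.
  have si : `|q.1| + 1 + r <= s^-1.
    by rewrite -[leLHS]invrK lef_pV2 ?posrE// ?invr_gt0// ge_min lexx orbT.
  have [T'' [/(tiling_closeP _ _ s0)[e es h] /(tiling_closeP _ _ s0)[e' es' h']]] :
      (tiling_close s T `&` tiling_close s T') !=set0.
    by apply: TT'; apply/nbhs_tilingP; exists s.
  exists (e' - e).
    by apply: le_lt_trans (ler_normB _ _) _; lra.
  have qp := omega_pos q.2.
  have n1 := ler_norm q.1; have n2 : - q.1 <= `|q.1| by rewrite -normrN ler_norm.
  have n3 := ler_norm e; have n4 : - e <= `|e| by rewrite -normrN ler_norm.
  have n5 := ler_norm e'; have n6 : - e' <= `|e'| by rewrite -normrN ler_norm.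
  have T''q : tiles T'' (q.1 - e, q.2).
    by apply/translateE; apply: (iffLR (h q _ _)) => //; lra.
  apply: (iffRL (h' (q.1 + (e' - e), q.2) _ _)) => /=; [lra|lra|].
  by apply/translateE; rewrite /= addrA addrAC addrK.
(* If [q'] started before [q.1], a sufficiently small translate of [q] would start strictly inside
   [q'], which uniqueness forbids. *)
have qstart : q'.1 = q.1.
  have [//|lt_q'q] := eqVneq q'.1 q.1.
  have /andP[h1 h2] := q'q.
  have [|e] := near_eq (Num.min (q.1 - q'.1) (q'.1 + omega ord0 q'.2 - q.1)).
    by rewrite lt_min !subr_gt0 h2 andbT lt_neqAle lt_q'q.
  rewrite lt_min !ltr_norml => /andP[/andP[e1 e2] /andP[e3 e4]] Te.
  have qe : q' = (q.1 + e, q.2).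
    apply: (geom_uniq gT' Tq' Te (y := q.1 + e)).
      by rewrite /tile_covers; apply/andP; split; lra.
    exact: (covers_start omega_pos (q.1 + e, q.2)).
  by exfalso; move: e1; rewrite qe /=; lra.
have [|e em Te] := near_eq omin; first by [].
move: em; rewrite ltr_norml => /andP[e1 e2].
have h1 := omin_le omega_pos q.2; have h2 := omin_le omega_pos q'.2.
have qe : q' = (q.1 + e, q.2).
  have [e0|e0] := leP e 0.
    apply: (geom_uniq gT' Tq' Te (y := q.1)) => //.
    by rewrite /tile_covers /=; apply/andP; split; lra.
  apply: (geom_uniq gT' Tq' Te (y := q.1 + e)).
    by rewrite /tile_covers /= qstart; apply/andP; split; lra.
  exact: (covers_start omega_pos (q.1 + e, q.2)).
move: qstart; rewrite qe /= => /eqP; rewrite -subr_eq0 addrAC subrr add0r => /eqP e0.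
by move: Te; rewrite e0 addr0 -surjective_pairing.
Qed.

(** Separates the positions of a tiling into a part depending on its word alone and the offset
    [pos T 0], the two data along which limits are taken in the compactness proof. *)
Definition word_pos (w : int -> 'I_d) (i : int) : R :=
  match i with
  | Posz n => \sum_(k < n) omega ord0 (w k%:Z)
  | Negz n => - \sum_(k < n.+1) omega ord0 (w (Negz k))
  end.

Lemma word_pos_next w i : word_pos w (i + 1) = word_pos w i + omega ord0 (w i).
Proof.
case: i => n; first by rewrite -PoszD addn1 /= big_ord_recr.
have -> : Negz n + 1 = - n%:Z by rewrite NegzE; lia.
case: n => [|n]; rewrite -?NegzE /=.
  by rewrite big_ord0 big_ord1 addrC subrr.
by rewrite [in RHS]big_ord_recr /= opprD addrNK.
Qed.

Lemma pos_word_pos T i : pos T i = pos T 0 + word_pos (lab T) i.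
Proof.
elim/int_rec: i => [|n IH|n IH].
- by rewrite /= big_ord0 addr0.
- by rewrite -addn1 PoszD pos_next// word_pos_next IH addrA.
- have := pos_next omega_pos T (- n.+1%:Z).
  have := word_pos_next (lab T) (- n.+1%:Z).
  have -> : - n.+1%:Z + 1 = - n%:Z by lia.
  by rewrite IH; lra.
Qed.

Lemma eq_word_pos w w' (M : nat) : (forall j : int, `|j| <= M%:Z -> w j = w' j) ->
  forall i : int, `|i| <= M%:Z -> word_pos w i = word_pos w' i.
Proof.
move=> ww' [n|n] iM /=; last congr (- _); apply: eq_bigr => k _; rewrite ww'//;
  have := ltn_ord k; lia.
Qed.

(** Consecutive positions differ by at least [omin], so a tile meeting [-B, B] has bounded index.
    Agreement of words on a finite window thus gives agreement of tilings on a ball. *)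
Lemma index_bound (w : int -> 'I_d) (x : int -> R) (B : R) (i : int) :
  (forall j : int, x (j + 1) = x j + omega ord0 (w j)) ->
  - omax <= x 0 <= 0 -> 0 <= B -> x i <= B -> - B <= x i + omega ord0 (w i) ->
  `|i| <= (Num.truncn ((B + omax) / omin)).+1%:Z.
Proof.
move=> x_next /andP[x0 x0'] B0 xB Bx.
have m0 := omin_gt0 omega_pos (w 0).
have wm := le_omax omega_pos (w i).
have h n : n%:R * omin <= B + omax -> (n <= (Num.truncn ((B + omax) / omin)).+1)%N.
  rewrite -ler_pdivlMr// => hn; rewrite -(ler_nat R).
  by apply: le_trans hn _; apply: ltW; exact: Num.Theory.truncnS_gt.
move: h; set M := (Num.truncn _).+1 => h.
case: i xB Bx wm => n xB Bx wm.
  suff : (n <= M)%N by lia.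
  by apply: h; have := seq_posD omega_pos x_next 0 n; rewrite add0r; lra.
suff : (n.+1 <= M)%N by lia.
apply: h; have := seq_posD omega_pos x_next (Negz n) n.+1.
by rewrite {2}NegzE addNr; lra.
Qed.

Lemma ultra_constant (X : Type) (F : set_system X) (g : X -> 'I_d) :
  UltraFilter F -> exists a, F [set x | g x = a].
Proof.
move=> FU; apply: contrapT => h.
have /filter_forall : forall a : 'I_d, \forall x \near F, g x <> a.
  move=> a; have [Fa|//] := in_ultra_setVsetC [set x | g x = a] FU.
  by case: h; exists a.
by move=> /filter_ex[x] /(_ (g x)).
Qed.

(** Along an ultrafilter each letter is constant, the alphabet being finite, and the position of
    tile 0 converges in a compact interval. The limit letters and the limit position define the
    limit tiling. *)
Lemma tiling_space_compact : compact [set: TS].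
Proof.
rewrite compact_ultra => F FU _.
have /choice[w Fw] : forall i, exists a, F [set T : TS | lab T i = a].
  by move=> i; exact: ultra_constant.
have bpos T : - omax <= pos T 0 <= 0.
  have := pos_next omega_pos T 0; rewrite add0r => e.
  have := le_omax omega_pos (lab T 0).
  by have /andP[-> h] := pos0 omega_pos T; rewrite andbT; lra.
pose F0 := (fun T : TS => pos T 0) @ F.
have [x0 [/= x0I clx0]] : `[- omax, 0] `&` cluster F0 !=set0.
  apply: segment_compact.
  by apply: (@filterS _ F _ setT) => [T _|]; [rewrite /= in_itv; exact: bpos|exact: filterT].
rewrite in_itv /= in x0I.
have Fpos (r : R) : 0 < r -> F [set T : TS | `|x0 - pos T 0| < r].
  move=> r0; have [//|nF] := in_ultra_setVsetC [set T : TS | `|x0 - pos T 0| < r] FU.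
  have [y []] := clx0 [set y | ~ `|x0 - y| < r] (ball x0 r) nF (nbhsx_ballx _ _ r0).
  by [].
have Flab (M : nat) : F [set T : TS | forall j : int, `|j| <= M%:Z -> w j = lab T j].
  have /filter_forall : forall k : 'I_(M + M).+1,
      \forall T \near F, lab T (k%:Z - M%:Z) = w (k%:Z - M%:Z).
    by move=> k; exact: Fw.
  apply: filterS => T hT j jM.
  have kM : (absz (j + M%:Z)%R < (M + M).+1)%N by lia.
  have := hT (Ordinal kM); rewrite /=.
  by have -> : (absz (j + M%:Z)%R)%:Z - M%:Z = j by lia.
pose x i := x0 + word_pos w i.
have x_next i : x (i + 1) = x i + omega ord0 (w i).
  by rewrite /x word_pos_next addrA.
have aw : biinf_allowed phi w.
  move=> k n; have /filter_ex[T hT] := Flab (absz k + n)%N.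
  suff -> : Defs.factor w k n = Defs.factor (lab T) k n by exact: tiling_allowed.
  apply/eq_in_map => i; rewrite mem_iota => /andP[_ ilt]; apply: hT; lia.
(* In the limit [x 1] may equal 0, and then the origin no longer belongs to tile 0; [geom_tiling]
   renumbers the tiles. *)
have [T tT] : exists T : TS, tiles T = seq_tiles w x.
  by apply: geom_tiling => //; apply/geom_seq.
exists T; split=> // A /nbhs_tilingP[r r0 rA].
apply: filterS rA _.
have ri : 0 < r^-1 by rewrite invr_gt0.
(* The additional r absorbs the shift between the two offsets. *)
pose B := r^-1 + r.
apply: filterS (filterI (Fpos r r0) (Flab (Num.truncn ((B + omax) / omin)).+1)).
move=> T' [/= er hl]; apply/tiling_closeP => //; exists (x0 - pos T' 0) => //.
have wp := eq_word_pos hl.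
have Bge0 : 0 <= B by rewrite /B; lra.
have [n1 n2] : x0 - pos T' 0 <= r /\ - r <= x0 - pos T' 0.
  by move: er; rewrite ltr_norml => /andP[? ?]; split; lra.
rewrite tT => q q1 q2; rewrite translateE; split.
  move=> [i _ qi]; exists i => //.
  have iM : `|i| <= (Num.truncn ((B + omax) / omin)).+1%:Z.
    apply: (index_bound x_next) => //; last 2 first.
    - by move: q1; rewrite -qi /= /B; lra.
    - by move: q2; rewrite -qi /= /B; lra.
    - by rewrite /x /= big_ord0 addr0.
  rewrite -qi /= -hl// pos_word_pos -wp//; congr pair; rewrite /x; lra.
move=> [i _ [qi1 qi2]]; exists i => //.
have iM : `|i| <= (Num.truncn ((B + omax) / omin)).+1%:Z.
  apply: (index_bound (pos_next omega_pos T')) => //; first by rewrite qi1 /B; lra.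
  by rewrite qi1 qi2 /B; lra.
rewrite (surjective_pairing q) -qi2 -hl//; congr pair.
by move: qi1; rewrite pos_word_pos -wp// /x; lra.
Qed.

End TilingTopology.

(** * Inflation *)

Section Inflation.
Context {R : realType} {d : nat} (omega : 'rV[R]_d) (phi : 'I_d -> seq 'I_d) (lambda : R).
Hypothesis phi_primitive : primitive_subst phi.
Hypothesis omega_pos : forall a, 0 < omega ord0 a.
Hypothesis lambda_gt1 : 1 < lambda.
Hypothesis omega_eigenvector : omega *m transition_mx R phi = lambda *: omega.

Local Notation TS := (tiling_space omega phi).
Local Notation agree := (agree omega).
Local Notation covers := (tile_covers omega).
Local Notation omin := (omin omega).
Local Notation omax := (omax omega).
Local Notation geom := (geom omega phi).
Local Notation infl := (infl omega phi lambda).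
Local Notation Phi := (@inflation R d phi omega lambda).
Local Notation wlen := (wlen omega).
Implicit Types (T S : TS) (C D : set (@ltile R d)).

Let lambda_gt0 : 0 < lambda.
Proof. by move: lambda_gt1; lra. Qed.

Let expl_gt0 n : 0 < lambda ^+ n.
Proof. exact: exprn_gt0. Qed.

Let expl_ge1 n : 1 <= lambda ^+ n.
Proof. by apply: exprn_ege1; exact: ltW. Qed.

Lemma expr_unbounded (r : R) : exists n0, forall n, (n0 <= n)%N -> r <= lambda ^+ n.
Proof.
have l0 : 0 < lambda - 1 by move: lambda_gt1; lra.
have bern n : n%:R * (lambda - 1) <= lambda ^+ n.
  elim: n => [|n IH]; first by rewrite mul0r expr0.
  rewrite -natr1 mulrDl mul1r exprS.
  have := expl_ge1 n; move: IH; set z := lambda ^+ n; set y := n%:R * _ => IH z1.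
  have : (lambda - 1) * 1 <= (lambda - 1) * z by rewrite ler_pM2l.
  by rewrite mulrBl mul1r mulr1; lra.
exists (Num.truncn (r / (lambda - 1))).+1 => n hn.
apply: le_trans (bern n); rewrite -ler_pdivrMr//.
apply: (@le_trans _ _ (Num.truncn (r / (lambda - 1))).+1%:R); last by rewrite ler_nat.
by apply: ltW; exact: Num.Theory.truncnS_gt.
Qed.

Lemma inflateE T : inflate lambda T = infl (tiles T).
Proof.
apply/seteqP; split=> [q [i _ iq]|q [_ [i _ <-] iq]]; last by exists i.
by exists (pos T i, lab T i) => //; exists i.
Qed.

(** The inflated collection is the collection of some tiling, so [xget] returns a solution and not
    its default. *)
Lemma tiles_inflation T : tiles (Phi T) = infl (tiles T).
Proof.
have [T' TT'] : exists T', tiles T' = infl (tiles T).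
  apply: geom_tiling => //; apply: geom_infl => //; exact: geom_tiles.
rewrite -inflateE.
have : [set T' | tiles T' = inflate lambda T] T' by rewrite /= inflateE.
by move=> h; exact: (xgetPex T (ex_intro _ T' h)).
Qed.

Lemma tiles_iter_inflation n T : tiles (iter n Phi T) = iter n infl (tiles T).
Proof. by elim: n => //= n IH; rewrite tiles_inflation IH. Qed.

Lemma inflation_continuous : continuous Phi.
Proof.
move=> T A /(nbhs_tilingP omega_pos)[r r0 rA]; apply/nbhs_tilingP => //.
(* Inflation multiplies the shift by lambda, whence the division; the radius of agreement only
   grows, to lambda^2 / r. *)
exists (r / lambda); first by rewrite divr_gt0.
move=> T' /(tiling_closeP omega_pos _ _ (divr_gt0 r0 lambda_gt0))[e er h].
apply: rA; apply/tiling_closeP => //; exists (lambda * e).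
  by rewrite normrM (gtr0_norm lambda_gt0) mulrC -ltr_pdivlMr.
rewrite !tiles_inflation -infl_translate.
apply: agree_sub (agree_infl omega_pos lambda_gt1 omega_eigenvector h).
rewrite invf_div mulrA ler_pdivlMr// mulVf ?gt_eqF//.
by move: lambda_gt1; nra.
Qed.

Lemma wlen_infix u v : infix u v -> wlen u <= wlen v.
Proof. by move=> /(word_tiles_infix omega_pos)[y [y0 h] _]; lra. Qed.

(** Such a [v] is a factor of some phi^M(i). Its length forces k <= M, so phi^M(i) splits into
    blocks phi^k(c) of length at most lambda^k [omax], and [v] is long enough to contain one of
    them. *)
Lemma lang_long k v : lang phi v -> lambda ^+ k * omax *+ 2 <= wlen v ->
  exists j, infix (subst_pow phi k j) v.
Proof.
move=> [M [i vi]] vk.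
have om := omax_gt0 omega_pos i.
have := wlen_infix vi; rewrite (wlen_pow omega_eigenvector) => vM.
have pk : 0 < lambda ^+ k * omax by rewrite mulr_gt0.
have [kM|Mk] := leqP k M; last first.
  have : lambda ^+ M * omega ord0 i <= lambda ^+ k * omax.
    apply: ler_pM; rewrite ?(ltW (expl_gt0 M)) ?(ltW (omega_pos i)) ?le_omax//.
    by rewrite ler_eXn2l// ltnW.
  by move: vk; rewrite mulr2n => vk ?; exfalso; lra.
apply: (infix_flatten_long omega_pos pk _ vk (y := subst_pow phi (M - k) i)).
  by move=> j; rewrite (wlen_pow omega_eigenvector) ler_pM2l// le_omax.
by rewrite -iter_subst_wordE -subst_powD subnKC.
Qed.

(** Some power of phi has [u] in the image of every letter, and a long enough chain of [C] contains
    one of these images. *)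
Lemma lang_occurs C u : geom C -> lang phi u ->
  exists x, word_tiles omega u x `<=` C.
Proof.
move=> gC /(lang_recurrent phi_primitive)[k0 /(_ k0 (leqnn _)) uk].
have r0 : 0 <= lambda ^+ k0 * omax *+ 2.
  have [q _ _] := geom_cover gC 0.
  by rewrite mulrn_wge0// mulr_ge0// ltW// (omax_gt0 omega_pos q.2).
have [v [x [vC x0 xv _ _]]] := geom_chain omega_pos gC 0 r0.
have [|j jv] := lang_long (geom_lang gC vC) (k := k0); first by lra.
have [z _ hz] := word_tiles_infix omega_pos (infix_trans (uk j) jv).
by exists (x + z); exact: subset_trans vC.
Qed.

(** A tile meeting [-r, r] starts between - r - [omax] and r, hence at a point covered by the common
    chain, and so belongs to it. *)
Lemma chain_agree C D u x r : tiles_disjoint omega C -> tiles_disjoint omega D ->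
  word_tiles omega u x `<=` C -> word_tiles omega u x `<=` D ->
  x <= - r - omax -> r < x + wlen u -> agree r C D.
Proof.
move=> + + + + xr ru q q1 q2.
wlog suff sub : C D / tiles_disjoint omega C -> word_tiles omega u x `<=` C ->
    word_tiles omega u x `<=` D -> C q -> D q.
  by move=> dC dD uC uD; split; exact: sub.
move=> dC uC uD Cq.
have [p up pq] : exists2 p, word_tiles omega u x p & covers p q.1.
  by apply: word_tiles_cover; have h := le_omax omega_pos q.2; apply/andP; split; lra.
by rewrite (dC _ _ q.1 Cq (uC _ up))//; [exact: uD|exact: covers_start].
Qed.

Lemma inflation_surj T : exists S, Phi S = T.
Proof.
suff : (Phi @` setT) T by case=> S _ <-; exists S.
have cl : closed (Phi @` setT).
  apply: compact_closed; first exact: tiling_space_hausdorff.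
  apply: continuous_compact; last exact: tiling_space_compact.
  exact/continuous_subspaceT/inflation_continuous.
apply: cl => A /(nbhs_tilingP omega_pos)[r r0 rA].
have gT := geom_tiles omega_pos T.
have ri : 0 < r^-1 by rewrite invr_gt0.
have om : 0 < omax := omax_gt0 omega_pos (lab T 0).
have [u [x [uT ux xu]]] : exists u x, [/\ word_tiles omega u x `<=` tiles T,
    x <= - r^-1 - omax & r^-1 < x + wlen u].
  have [|u [x [h1 h2 h3 _ _]]] := geom_chain omega_pos gT (- r^-1 - omax) (r := r^-1 *+ 2 + omax).
    by rewrite mulr2n; lra.
  by exists u, x; split=> //; move: h3; rewrite mulr2n; lra.
(* The exponent k0 + 1 places [u] inside phi(v) with [v] allowed, so that inflating a tiling
   containing [v] produces [u]. *)
have [k0 /(_ k0.+1 (leqnSn _) (lab T 0))] := lang_recurrent phi_primitive (geom_lang gT uT).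
set v := subst_pow phi k0 (lab T 0).
have -> : subst_pow phi k0.+1 (lab T 0) = subst_word phi v by [].
move=> /(word_tiles_infix omega_pos)[z _ hz].
have [y vy] : exists y, word_tiles omega v y `<=` tiles T.
  by apply: lang_occurs => //; exists k0, (lab T 0); exact: infix_refl.
(* Inflation carries the copy of [v] at y to a copy of [u] at lambda y + z; translating by e
   beforehand moves the latter to x. *)
pose e := (x - (lambda * y + z)) / lambda.
have gD := geom_translate gT e.
have [S DS] := geom_tiling omega_pos gD.
exists (Phi S); split; first by exists S.
apply: rA; apply/tiling_closeP => //; exists 0; first by rewrite normr0.
rewrite translate0 tiles_inflation DS.
apply: (chain_agree (u := u) (x := x)) => //; first exact: geom_uniq gT.
  exact: geom_uniq (geom_infl omega_pos lambda_gt1 omega_eigenvector gD).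
rewrite infl_translate => q uq; apply/translateE.
have vT := @infl_sub _ _ omega phi lambda _ _ vy; rewrite (infl_word_tiles omega_eigenvector) in vT.
apply/vT/hz; have := uq.
have -> : x = lambda * y + z + lambda * e.
  by rewrite /e [lambda * (_ / _)]mulrC divfK ?gt_eqF// addrC subrK.
by move/word_tilesD.
Qed.

Lemma iter_inflation_surj n T : exists S, iter n Phi S = T.
Proof.
elim: n T => [|n IH] T; first by exists T.
by have [S1 <-] := inflation_surj T; have [S <-] := IH S1; exists S.
Qed.

End Inflation.

(** * Recognizability *)

Section Recognizability.
Context {R : realType} {d : nat} (omega : 'rV[R]_d) (phi : 'I_d -> seq 'I_d) (lambda : R).
Hypothesis phi_primitive : primitive_subst phi.
Hypothesis omega_pos : forall a, 0 < omega ord0 a.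
Hypothesis lambda_gt1 : 1 < lambda.
Hypothesis omega_eigenvector : omega *m transition_mx R phi = lambda *: omega.

Local Notation TS := (tiling_space omega phi).
Local Notation agree := (agree omega).
Local Notation covers := (tile_covers omega).
Local Notation omin := (omin omega).
Local Notation omax := (omax omega).
Local Notation geom := (geom omega phi).
Local Notation infl := (infl omega phi lambda).
Local Notation Phi := (@inflation R d phi omega lambda).
Local Notation wlen := (wlen omega).
Implicit Types (T S : TS) (C D : set (@ltile R d)).

Let lambda_gt0 : 0 < lambda.
Proof. by move: lambda_gt1; lra. Qed.

Let expl_gt0 n : 0 < lambda ^+ n.
Proof. exact: exprn_gt0. Qed.

Let expl_ge1 n : 1 <= lambda ^+ n.
Proof. by apply: exprn_ege1; exact: ltW. Qed.

(** A translation that maps tiles to tiles respects adjacency, so it acts on indices by adding the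
    constant [j 0], nonzero because e is. A negative constant is read backwards. *)
Lemma tiling_period T (e : R) : e != 0 ->
  (forall q, tiles T q -> tiles T (q.1 + e, q.2)) -> shift_periodic (lab T).
Proof.
move=> e0 Te.
have /choice[j jP] i : exists j, (pos T j, lab T j) = (pos T i + e, lab T i).
  by have [|j _ ej] := Te (pos T i, lab T i); [exists i|exists j].
have jpos i : pos T (j i) = pos T i + e by case: (jP i).
have jlab i : lab T (j i) = lab T i by case: (jP i).
have pos_inj : injective (pos T).
  by apply: inc_inj; apply: le_mono; exact: tiling_left_to_right.
have jS i : j (i + 1) = j i + 1.
  apply: pos_inj; rewrite jpos !pos_next// jpos jlab; lra.
have jE i : j i = i + j 0.
  elim/int_rec: i => [|n IH|n IH]; first by rewrite add0r.
    by rewrite -addn1 PoszD jS IH; lia.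
  have := jS (- n.+1%:Z); have -> : - n.+1%:Z + 1 = - n%:Z by lia.
  by rewrite IH; lia.
have j0 : j 0 != 0.
  by apply/eqP => h; have := jpos 0; rewrite h; move/eqP: e0; lra.
have per i : lab T (i + j 0) = lab T i by rewrite -jE jlab.
case: (j 0) j0 per => n n0 per.
  exists n => //; first by case: n n0 {per}.
exists n.+1 => // i; rewrite -(per (i + n.+1%:Z)).
by congr (lab T _); rewrite NegzE addrK.
Qed.

(** There are finitely many two-letter words, so one exponent serves all of them. Pairs suffice
    because a patch shorter than every n-th level supertile meets at most two adjacent ones. *)
Lemma two_letter_recurrent : exists k, forall a b, lang phi [:: a; b] ->
  forall c, infix [:: a; b] (subst_pow phi k c).
Proof.
have /choice[k kP] : forall ab : 'I_d * 'I_d, exists k0, lang phi [:: ab.1; ab.2] ->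
    forall k, (k0 <= k)%N -> forall c, infix [:: ab.1; ab.2] (subst_pow phi k c).
  move=> ab; have [/(lang_recurrent phi_primitive)[k0 h]|nl] := pselect (lang phi [:: ab.1; ab.2]).
    by exists k0.
  by exists 0%N.
exists (\max_ab k ab)%N => a b lab c.
by apply: (kP (a, b)) => //; exact: leq_bigmax.
Qed.

(** The least n with M <= lambda^n [omin] works. At this level every supertile has length at least
    M, and yet the supertiles are only a constant factor longer than M. *)
Lemma expr_between (M : R) : 0 < omin -> 1 <= M -> exists n,
  M <= lambda ^+ n * omin /\ lambda ^+ n <= (1 + lambda / omin) * M.
Proof.
move=> m0 M1; have ex_n : exists n, M <= lambda ^+ n * omin.
  have [n /(_ n (leqnn n)) h] := expr_unbounded lambda_gt1 (M / omin).
  by exists n; rewrite -ler_pdivrMr.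
have lm : 0 < lambda / omin by rewrite divr_gt0.
case: (ex_minnP ex_n) => -[|n] hn nmin; first last.
  exists n.+1; split=> //.
  have : lambda ^+ n * omin < M.
    by rewrite ltNge; apply/negP => /nmin; rewrite ltnn.
  rewrite -ltr_pdivlMr// => h; rewrite exprS mulrDl mul1r.
  have := ltW h; rewrite -(ler_pM2l lambda_gt0) mulrCA mulrC => h'.
  by rewrite mulrAC -mulrA mulrC; lra.
exists 0%N; split=> //; rewrite expr0 mulrDl mul1r.
by rewrite (le_trans M1)// lerDl mulr_ge0//; lra.
Qed.

(* A long patch invariant under a short translation contains a copy of every
   patch whose size is comparable to the translation, so that translation would
   be a period of every tiling. *)
Lemma patch_aperiodic T0 : ~ shift_periodic (lab T0) ->
  exists2 B, 0 < B & forall D M e, geom D -> 1 <= M -> `|e| <= M ->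
    agree (B * M) D (translate e D) -> e = 0.
Proof.
move=> T0aper; have [N NP] := two_letter_recurrent.
have m0 : 0 < omin := omin_gt0 omega_pos (lab T0 0).
have om0 : 0 < omax := omax_gt0 omega_pos (lab T0 0).
(* A chain of length 2 lambda^(N+n) [omax] contains every pair of adjacent n-th level supertiles,
   and lambda^n <= (1 + lambda / [omin]) M; the final 1 pays for the overshoot by one tile. *)
pose B0 := 2 * lambda ^+ N * (1 + lambda / omin) + 1.
have lm : 0 < lambda / omin by rewrite divr_gt0.
have B00 : 0 < B0 by rewrite /B0 addr_gt0// mulr_gt0// ?mulr_gt0//; lra.
exists (B0 * omax); first exact: mulr_gt0.
move=> D M e gD M1 eM De; apply: contrapT => /eqP e0; apply: T0aper.
apply: (tiling_period e0) => q Tq.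
have [n [Mn nM]] := expr_between m0 M1.
have gT0 := geom_tiles omega_pos T0.
have [S ST] := iter_inflation_surj phi_primitive omega_pos lambda_gt1 omega_eigenvector n T0.
have gS := geom_tiles omega_pos S.
have TS0 : tiles T0 = iter n infl (tiles S) by rewrite -ST tiles_iter_inflation.
have ln := expl_gt0 n.
have [n1 n2] : e <= M /\ - M <= e by move: eM; rewrite ler_norml => /andP[].
(* Since |e| <= lambda^n [omin], both [q.1] and [q.1 + e] lie over two adjacent n-th level
   supertiles; the second is chosen on the side given by the sign of e. *)
have [a [b [y [abS y1 y2 y3 y4]]]] : exists a b y, [/\ word_tiles omega [:: a; b] y `<=` tiles S,
    lambda ^+ n * y <= q.1, q.1 < lambda ^+ n * (y + wlen [:: a; b]),
    lambda ^+ n * y <= q.1 + e & q.1 + e < lambda ^+ n * (y + wlen [:: a; b])].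
  have [p Sp /andP[]] := geom_cover gS (q.1 / lambda ^+ n).
  rewrite ler_pdivlMr// ltr_pdivrMr// ![_ * lambda ^+ n]mulrC => p1 p2.
  have [e1|e1] := leP 0 e.
    have [b Sb] := geom_next omega_pos gS Sp.
    exists p.2, b, p.1; rewrite wlen_cons wlen1.
    have : lambda ^+ n * omin <= lambda ^+ n * omega ord0 b by rewrite ler_pM2l// omin_le.
    have : 0 < lambda ^+ n * omega ord0 b by rewrite mulr_gt0.
    rewrite !mulrDr in p2 *; split=> //; try lra.
    by move=> _ [->|[->|//]] //; rewrite -surjective_pairing.
  have [b Sb] := geom_prev omega_pos gS Sp.
  exists b, p.2, (p.1 - omega ord0 b); rewrite wlen_cons wlen1 addrA subrK.
  have : lambda ^+ n * omin <= lambda ^+ n * omega ord0 b by rewrite ler_pM2l// omin_le.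
  have : 0 < lambda ^+ n * omega ord0 b by rewrite mulr_gt0.
  rewrite !(mulrDr, mulrBr) in p2 *; split=> //; try lra.
  by move=> _ [->|[->|//]] //; rewrite subrK -surjective_pairing.
set W := iter n (subst_word phi) [:: a; b].
have WT : word_tiles omega W (lambda ^+ n * y) `<=` tiles T0.
  by rewrite TS0 -(iter_infl_word_tiles omega_eigenvector); exact: iter_infl_sub.
have wW : wlen W = lambda ^+ n * wlen [:: a; b] by rewrite (wlen_iter omega_eigenvector).
have Wcov z : lambda ^+ n * y <= z -> z < lambda ^+ n * (y + wlen [:: a; b]) ->
    exists2 p, word_tiles omega W (lambda ^+ n * y) p & covers p z.
  by move=> z1 z2; apply: word_tiles_cover; rewrite z1 wW -mulrDr z2.
have Wq : word_tiles omega W (lambda ^+ n * y) q.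
  have [p Wp pq] := Wcov q.1 y1 y2.
  by rewrite (geom_uniq gT0 Tq (WT _ Wp) (covers_start omega_pos q) pq).
have [q' Wq' q'q] := Wcov (q.1 + e) y3 y4.
(* A copy in [D], close to the origin, of the patch [W] that contains [q] and covers [q.1 + e]. *)
have [t [WD t1 t2]] : exists t, [/\ word_tiles omega W t `<=` D, - omax <= t &
    t + wlen W <= 2 * lambda ^+ (N + n) * omax + omax].
  have r0 : 0 <= 2 * lambda ^+ (N + n) * omax.
    by rewrite !mulr_ge0// ?ltW.
  have [v [x [vD x1 x2 x3 x4]]] := geom_chain omega_pos gD 0 r0.
  have [|j jv] := lang_long omega_pos lambda_gt1 omega_eigenvector
    (geom_lang gD vD) (k := (N + n)%N).
    by rewrite -mulr_natl mulrA; lra.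
  have Wv : infix W v.
    apply: infix_trans jv; rewrite addnC subst_powD; apply: iter_subst_word_infix.
    by apply: NP; exact: geom_lang abS.
  have [z [z0 zv] hz] := word_tiles_infix omega_pos Wv.
  exists (x + z); split; [exact: subset_trans vD|lra|lra].
pose s := t - lambda ^+ n * y.
have shiftD p : word_tiles omega W (lambda ^+ n * y) p -> D (p.1 + s, p.2).
  move=> Wp; apply: WD; have -> : t = lambda ^+ n * y + s by rewrite /s addrC subrK.
  by apply/word_tilesD; rewrite /= addrK -surjective_pairing.
(* The copy lies in the ball where [D] is invariant under e. The translate of the copied [q] is
   therefore a tile of [D], and its start is covered by the copy of [q']; by uniqueness they
   coincide, and undoing the shift s brings this back to [T0]. *)
have Dqs : D (q.1 + s + e, q.2).
  have t3 : t + wlen W <= B0 * omax * M.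
    apply: le_trans t2 _; rewrite exprD.
    have : lambda ^+ N * lambda ^+ n * omax <= lambda ^+ N * ((1 + lambda / omin) * M) * omax.
      by rewrite ler_pM2r// ler_pM2l.
    have : omax * 1 <= omax * M by rewrite ler_pM2l.
    by rewrite /B0; set l := lambda / omin; set k := lambda ^+ N; set k' := lambda ^+ n; lra.
  have qp := omega_pos q.2.
  have B1 : omax <= B0 * omax * M.
    have h1 : 0 < 2 * lambda ^+ N * (1 + lambda / omin) by rewrite mulr_gt0// ?mulr_gt0//; lra.
    have h2 : omax * 1 <= omax * M by rewrite ler_pM2l.
    have h3 : 0 < 2 * lambda ^+ N * (1 + lambda / omin) * (omax * M).
      by rewrite mulr_gt0// mulr_gt0//; lra.
    by rewrite /B0; lra.
  apply: (iffRL (De (q.1 + s + e, q.2) _ _)) => /=.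
  - by move: y4; rewrite mulrDr -wW /s; lra.
  - by rewrite /s; lra.
  - by apply/translateE; rewrite /= addrK; exact: shiftD.
have [h1 h2] : (q.1 + s + e, q.2) = (q'.1 + s, q'.2).
  apply: (geom_uniq gD Dqs (shiftD _ Wq') (y := q.1 + s + e)).
    exact: (covers_start omega_pos (q.1 + s + e, q.2)).
  by move: q'q; rewrite /tile_covers /= => /andP[? ?]; apply/andP; split; lra.
suff -> : (q.1 + e, q.2) = q' by exact: WT.
by rewrite (surjective_pairing q') h2; congr pair; lra.
Qed.

Lemma inflation_inj T0 : ~ shift_periodic (lab T0) -> injective Phi.
Proof.
move=> /patch_aperiodic[B B0 aper] S S' SS'.
have /choice[Psi PsiK] := inflation_surj phi_primitive omega_pos lambda_gt1 omega_eigenvector.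
have iterK n T : iter n Phi (iter n Psi T) = T.
  by elim: n T => //= n IH T; rewrite -iterS iterSr PsiK.
have gS T := geom_tiles omega_pos T.
pose u n : TS * TS := (iter n Psi S, iter n Psi S').
(* Clustering in the product makes the same pair of indices serve both sequences. *)
have [[A A'] [_ clA]] : [set: TS] `*` [set: TS] `&` cluster (u @ \oo) !=set0.
  have cpt := tiling_space_compact (phi := phi) omega_pos.
  by apply: (compact_setX cpt cpt); exists 0%N.
(* Both g and g' will be at most 2 r in absolute value, so their difference is at most 4 r <= 1; the
   radius r^-1 - r, reduced by the 2 r lost in translating back, remains at least B and at least
   1. *)
pose r := Num.min (4%:R^-1 : R) (B + 1)^-1.
have r0 : 0 < r by rewrite lt_min !invr_gt0; apply/andP; split; lra.
have r4 : r <= 4%:R^-1 by rewrite ge_min lexx.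
have r4' : 4 <= r^-1 by rewrite -[leLHS]invrK lef_pV2 ?posrE.
have rB : B + 1 <= r^-1.
  rewrite -[leLHS]invrK lef_pV2 ?posrE// ?invr_gt0; last by lra.
  by rewrite ge_min lexx orbT.
have close_often m0 : exists m, (m0 <= m)%N /\
    (tiling_close r A (u m).1 /\ tiling_close r A' (u m).2).
  have nbA : nbhs (A, A') (tiling_close r A `*` tiling_close r A').
    exists (tiling_close r A, tiling_close r A') => //.
    by split; apply/(nbhs_tilingP omega_pos); exists r.
  have tail : (u @ \oo) [set p | exists2 m, (m0 <= m)%N & p = u m].
    by exists m0 => // m hm; exists m.
  have [_ [[m hm ->] [hA hA']]] := clA _ _ tail nbA.
  by exists m.
have [n [_ [An An']]] := close_often 0%N.
apply: (tiles_inj omega_pos); apply: (agree_eq omega_pos) => b b0.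
have [m0 hm0] := expr_unbounded lambda_gt1 b.
have [m [mn [Am Am']]] := close_often (maxn n.+1 m0).
have nm : (n < m)%N by apply: leq_trans mn; exact: leq_maxl.
have bm : b <= lambda ^+ m by apply: hm0; apply: leq_trans mn; exact: leq_maxr.
have shift (X Y Z : TS) : tiling_close r X Y -> tiling_close r X Z ->
    exists2 g, `|g| <= 2 * r & agree (r^-1 - r) (tiles Y) (translate g (tiles Z)).
  move=> /(tiling_closeP omega_pos _ _ r0)[e er h] /(tiling_closeP omega_pos _ _ r0)[e' er' h'].
  exists (- e + e').
    by apply: le_trans (ler_normD _ _) _; rewrite normrN; lra.
  rewrite -translateD -[X in agree _ X _]translate0 -(addNr e) -translateD.
  apply: (@agree_trans _ _ _ _ _ (translate (- e) (tiles X))).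
    by apply: agree_sym; apply: agree_translate h; rewrite normrN; lra.
  by apply: agree_translate h'; rewrite normrN; lra.
have [g gr hg] := shift _ _ _ An Am.
have [g' gr' hg'] := shift _ _ _ An' Am'.
have up k (X Y : TS) h : agree (r^-1 - r) (tiles X) (translate h (tiles Y)) ->
    agree (lambda ^+ k * (r^-1 - r)) (tiles (iter k Phi X))
      (translate (lambda ^+ k * h) (tiles (iter k Phi Y))).
  move=> /(agree_iter_infl omega_pos lambda_gt1 omega_eigenvector (n := k)).
  by rewrite iter_infl_translate !tiles_iter_inflation.
have top k (X : TS) : (n < k)%N -> iter k Phi (iter n Psi X) = iter (k - n.+1) Phi (Phi X).
  by move=> nk; rewrite -{1}(subnK nk) iterD iterS iterK.
(* The exponent is m + 1 because only Phi S and Phi S' are known to coincide: at this level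
   [iter m Psi S] becomes Phi S and [iter n Psi S] becomes an iterate of Phi S. *)
have gg' : g = g'.
  have h : agree (lambda ^+ m.+1 * (r^-1 - r)) (tiles (iter (m.+1 - n.+1) Phi (Phi S)))
      (translate (lambda ^+ m.+1 * g) (tiles (Phi S))).
    by have := up m.+1 _ _ _ hg; rewrite top ?ltnS ?(ltnW nm)// iterS iterK.
  have h' : agree (lambda ^+ m.+1 * (r^-1 - r)) (tiles (iter (m.+1 - n.+1) Phi (Phi S)))
      (translate (lambda ^+ m.+1 * g') (tiles (Phi S))).
    by have := up m.+1 _ _ _ hg'; rewrite top ?ltnS ?(ltnW nm)// iterS iterK -SS'.
  have Lm := expl_ge1 m.+1; have Lp := expl_gt0 m.+1.
  set L := lambda ^+ m.+1 in h h' Lm Lp.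
  have gg : `|g' - g| <= 1.
    by apply: le_trans (ler_normB _ _) _; lra.
  suff : L * (g' - g) = 0.
    by move=> /eqP; rewrite mulf_eq0 gt_eqF//= subr_eq0 => /eqP.
  apply: (aper (tiles (Phi S)) L) => //.
    by rewrite normrM gtr0_norm// ger_pMr.
  have := agree_trans (agree_sym h) h'.
  move=> /(@agree_translate _ _ _ _ (B * L) (- (L * g))).
  rewrite !translateD addNr translate0 [in L * (g' - g)]mulrBr [L * g' - _]addrC; apply.
  rewrite normrN normrM gtr0_norm//.
  have : L * `|g| <= L * (2 * r) by rewrite ler_pM2l.
  have : L * (B + 3 * r) <= L * r^-1 by rewrite ler_pM2l//; lra.
  lra.
(* One level lower, [iter m Psi S] becomes S itself, while n < m still makes [iter n Psi S] an
   iterate of Phi S, common to S and S'. *)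
have h : agree (lambda ^+ m * (r^-1 - r)) (tiles (iter (m - n.+1) Phi (Phi S)))
    (translate (lambda ^+ m * g) (tiles S)).
  by have := up m _ _ _ hg; rewrite top// iterK.
have h' : agree (lambda ^+ m * (r^-1 - r)) (tiles (iter (m - n.+1) Phi (Phi S)))
    (translate (lambda ^+ m * g) (tiles S')).
  by have := up m _ _ _ hg'; rewrite top// iterK -SS' -gg'.
exists (lambda ^+ m) => //.
have := agree_trans (agree_sym h) h'.
move=> /(@agree_translate _ _ _ _ (lambda ^+ m) (- (lambda ^+ m * g))).
rewrite !translateD addNr !translate0; apply.
rewrite normrN normrM gtr0_norm//.
have : lambda ^+ m * `|g| <= lambda ^+ m * (2 * r) by rewrite ler_pM2l.
have : lambda ^+ m * (1 + 3 * r) <= lambda ^+ m * r^-1 by rewrite ler_pM2l//; lra.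
lra.
Qed.

Lemma aperiodic_tiling : aperiodic_subst phi -> exists T, ~ shift_periodic (lab T).
Proof.
move=> [w [aw _ nw]].
have [|T lT _] := tiling_of_seq omega_pos (word_pos_next omega w) aw.
  by rewrite /= big_ord0 big_ord1 lexx omega_pos.
by exists T; rewrite lT.
Qed.

End Recognizability.

Lemma aperiodic_card {d : nat} (phi : 'I_d -> seq 'I_d) : aperiodic_subst phi -> (1 < d)%N.
Proof.
move=> [w [_ _ nw]]; rewrite ltnNge; apply/negP => d1; apply: nw.
exists 1%N => // k; apply: val_inj => /=.
by case: (w (k + 1%:Z)) => a a_d; case: (w k) => b b_d /=; lia.
Qed.

(** * The complex *)

Section ComplexTopology.
Context {R : realType} {d : nat} (phi : 'I_d -> seq 'I_d) (omega : 'rV[R]_d) (lambda : R).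
Hypothesis omega_pos : forall a, 0 < omega ord0 a.
Hypothesis lambda_gt1 : 1 < lambda.

Local Notation eps := (eps omega lambda).
Local Notation omin := (omin omega).
Local Notation K := (K phi omega lambda).
Local Notation edges := (edges phi omega lambda).
Local Notation edge := (edge phi).
Local Notation edge_dom := (edge_dom omega lambda).
Local Notation two_letter := (two_letter phi).
Local Notation K_at c x h := (@K_point R d phi omega lambda c x h).

Let lambda_gt0 : 0 < lambda.
Proof. by move: lambda_gt1; lra. Qed.

Lemma eps_gt0 (a : 'I_d) : 0 < eps.
Proof. by rewrite divr_gt0 ?(omin_gt0 omega_pos a)// mulr_gt0. Qed.

(** This is where lambda > 1 makes every letter edge a nondegenerate interval. *)
Lemma eps2_lt_omin (a : 'I_d) : 2 * eps < omin.
Proof.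
have -> : omin = lambda * (2 * eps).
  rewrite /Defs.eps -/omin; field; exact: lt0r_neq0.
by rewrite ltr_pMl// mulr_gt0// (eps_gt0 a).
Qed.

Lemma eps2_lt a : 2 * eps < omega ord0 a.
Proof. exact: lt_le_trans (eps2_lt_omin a) (omin_le omega_pos a). Qed.

Lemma K_point_eq (c c' : edge) x x' (h : edge_dom c x) (h' : edge_dom c' x') :
  c = c' -> x = x' -> K_at c x h = K_at c' x' h'.
Proof. by move=> cc xx; subst c' x'; congr (K_at _ _ _); exact: Prop_irrelevance. Qed.

Lemma K_pointP (k : K) : exists c x (h : edge_dom c x), k = K_at c x h.
Proof.
case: (repr k) (reprK k) => c [x cx] /= <-.
exists c, x, (set_mem cx); congr (\pi_ _ _)%qT.
by congr existT; apply: val_inj.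
Qed.

Lemma K_piP (q q' : edges) :
  (\pi_{eq_quot (glued_equiv phi omega lambda)} q =
   \pi_{eq_quot (glued_equiv phi omega lambda)} q')%qT <-> glued q q'.
Proof.
have P := @eqmodP _ (glued_equiv phi omega lambda) q q'.
by split=> [|h]; [move/P|apply/P].
Qed.

Section Lift.
Context {X : Type} (G : edge -> R -> X).
Hypothesis G_left : forall ab : two_letter,
  G (inl (val ab).1) (omega ord0 (val ab).1 - eps) = G (inr ab) (- eps).
Hypothesis G_right : forall ab : two_letter, G (inl (val ab).2) eps = G (inr ab) eps.

(** [G] takes any real coordinate, which avoids carrying membership proofs. Its values at glued ends
    agree, so the representative is immaterial; [X] will be the reals or a type of sets of tiles. *)
Definition K_lift (k : K) : X := let q := repr k in G (tag q) (Defs.coord q).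

Lemma glued_lift (q q' : edges) :
  glued q q' -> G (tag q) (Defs.coord q) = G (tag q') (Defs.coord q').
Proof.
move=> /asboolP; elim=> {q q'} [q q'|//|q q' _ -> //|q q' q'' _ -> _ -> //].
by case=> ab -> -> -> ->.
Qed.

Lemma K_liftE c x (h : edge_dom c x) : K_lift (K_at c x h) = G c x.
Proof.
have : glued (repr (K_at c x h)) (existT _ c (SigSub (mem_set h))).
  by apply/K_piP; rewrite reprK.
by move/glued_lift.
Qed.

End Lift.

Lemma K_lift_continuous (G : edge -> R -> R) :
  (forall ab : two_letter,
    G (inl (val ab).1) (omega ord0 (val ab).1 - eps) = G (inr ab) (- eps)) ->
  (forall ab : two_letter, G (inl (val ab).2) eps = G (inr ab) eps) ->
  (forall c, continuous (G c)) -> continuous (K_lift G : K -> R).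
Proof.
move=> G_left G_right G_cont.
apply: (@repr_comp_continuous _ _ _ (fun q : edges => G (tag q) (Defs.coord q))); last first.
  by move=> q q' /eqP/K_piP/(glued_lift G_left G_right)/eqP.
move=> [c s].
have : continuous (fun s : edge_dom c => G c (set_val s)).
  by move=> y; apply: continuous_comp; [exact: initial_continuous|exact: G_cont].
exact.
Qed.

Definition edge_lo (c : edge) : R := if c is inl a then eps else - eps.
Definition edge_hi (c : edge) : R := if c is inl a then omega ord0 a - eps else eps.

Lemma edge_dom_lo a : edge_dom (inl a : edge) eps.
Proof. by have := eps2_lt a; rewrite /= lexx /=; lra. Qed.

Lemma edge_dom_hi a : edge_dom (inl a : edge) (omega ord0 a - eps).
Proof. by have := eps2_lt a; rewrite /= lexx andbT; lra. Qed.

Lemma K_glue_left (ab : two_letter) h h' :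
  K_at (inl (val ab).1) (omega ord0 (val ab).1 - eps) h = K_at (inr ab) (- eps) h'.
Proof. by apply/K_piP/asboolP/rst_step; exact: (gluing_left (ab := ab)). Qed.

Lemma K_glue_right (ab : two_letter) h h' :
  K_at (inl (val ab).2) eps h = K_at (inr ab) eps h'.
Proof. by apply/K_piP/asboolP/rst_step; exact: (gluing_right (ab := ab)). Qed.

(** On the complex this is nonzero exactly in the interior of the edge [e], so it identifies the
    edge of an interior point. *)
Definition edge_bump (e c : edge) (x : R) : R :=
  if c == e then (x - edge_lo c) * (edge_hi c - x) else 0.

(* The vertex before a has height 2a, the vertex after a has height 2a + 1. *)
Definition edge_height (c : edge) (x : R) : R :=
  match c with
  | inl a => (2 * a)%:R + (x - eps) / (omega ord0 a - 2 * eps)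
  | inr ab => (2 * (val ab).1).+1%:R +
      (x + eps) / (2 * eps) * ((2 * (val ab).2)%:R - (2 * (val ab).1).+1%:R)
  end.

Lemma edge_bump_end e c : edge_bump e c (edge_lo c) = 0 /\ edge_bump e c (edge_hi c) = 0.
Proof. by rewrite /edge_bump; case: ifP => _; rewrite ?subrr ?mul0r ?mulr0. Qed.

Lemma edge_bump_cont e c : continuous (edge_bump e c).
Proof.
rewrite /edge_bump; case: eqP => _ x; last exact: cvg_cst.
apply: cvgM; first by apply: cvgB; [exact: cvg_id|exact: cvg_cst].
by apply: cvgB; [exact: cvg_cst|exact: cvg_id].
Qed.

Lemma edge_height_cont c : continuous (edge_height c).
Proof.
case: c => [a|ab] x; apply: cvgD; try exact: cvg_cst.
  by apply: cvgMr_tmp; apply: cvgB; [exact: cvg_id|exact: cvg_cst].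
by do 2 apply: cvgMr_tmp; apply: cvgD; [exact: cvg_id|exact: cvg_cst].
Qed.

Lemma edge_height_lo a : edge_height (inl a) (edge_lo (inl a : edge)) = (2 * a)%:R.
Proof. by rewrite /edge_height subrr mul0r addr0. Qed.

Lemma edge_height_hi a : edge_height (inl a) (edge_hi (inl a : edge)) = (2 * a).+1%:R.
Proof.
have := eps2_lt a; rewrite /edge_height /= -addrA -opprD => h.
have -> : eps + eps = 2 * eps by ring.
by rewrite divff ?natr1//; lra.
Qed.

Lemma edge_height_left (ab : two_letter) :
  edge_height (inl (val ab).1) (omega ord0 (val ab).1 - eps) = edge_height (inr ab) (- eps).
Proof.
have := eps2_lt (val ab).1; rewrite /edge_height addNr !mul0r addr0 -addrA -opprD => h.
have -> : eps + eps = 2 * eps by ring.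
by rewrite divff ?natr1//; lra.
Qed.

Lemma edge_height_right (ab : two_letter) :
  edge_height (inl (val ab).2) eps = edge_height (inr ab) eps.
Proof.
have := eps_gt0 (val ab).1; rewrite /edge_height subrr mul0r addr0 => h.
have -> : eps + eps = 2 * eps by ring.
have e2 : 2 * eps != 0 by rewrite gt_eqF// mulr_gt0.
by rewrite (divff e2) mul1r addrC subrK.
Qed.

(** Real continuous functions separate the points: [edge_bump] finds the edge of an interior point,
    its product with the coordinate recovers the coordinate, and [edge_height] tells the vertices
    apart. *)
Lemma K_hausdorff : hausdorff_space K.
Proof.
move=> k k' kk'.
have sep (g : K -> R) : continuous g -> g k = g k'.
  move=> g_cont; apply: (@Rhausdorff R) => A B nA nB.
  have [y [yA yB]] := kk' _ _ (g_cont _ _ nA) (g_cont _ _ nB).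
  by exists (g y).
have sepE (G : edge -> R -> R) : (forall ab : two_letter,
    G (inl (val ab).1) (omega ord0 (val ab).1 - eps) = G (inr ab) (- eps)) ->
    (forall ab : two_letter, G (inl (val ab).2) eps = G (inr ab) eps) ->
    (forall c, continuous (G c)) -> K_lift G k = K_lift G k'.
  by move=> h1 h2 h3; apply: (sep (K_lift G)); exact: K_lift_continuous.
have [c [x [h ek]]] := K_pointP k; have [c' [x' [h' ek']]] := K_pointP k'.
have bump e : edge_bump e c x = edge_bump e c' x'.
  have l (ab : two_letter) :
      edge_bump e (inl (val ab).1) (omega ord0 (val ab).1 - eps) = edge_bump e (inr ab) (- eps).
    by rewrite (edge_bump_end e (inl (val ab).1)).2 (edge_bump_end e (inr ab)).1.
  have r (ab : two_letter) : edge_bump e (inl (val ab).2) eps = edge_bump e (inr ab) eps.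
    by rewrite (edge_bump_end e (inl (val ab).2)).1 (edge_bump_end e (inr ab)).2.
  have := sepE _ l r (@edge_bump_cont e).
  by rewrite ek ek' !(K_liftE l r).
have xbump e : x * edge_bump e c x = x' * edge_bump e c' x'.
  pose G c y := y * edge_bump e c y.
  have l (ab : two_letter) : G (inl (val ab).1) (omega ord0 (val ab).1 - eps) = G (inr ab) (- eps).
    by rewrite /G (edge_bump_end e (inl (val ab).1)).2 (edge_bump_end e (inr ab)).1 !mulr0.
  have r (ab : two_letter) : G (inl (val ab).2) eps = G (inr ab) eps.
    by rewrite /G (edge_bump_end e (inl (val ab).2)).1 (edge_bump_end e (inr ab)).2 !mulr0.
  have G_cont c0 : continuous (G c0).
    by move=> y; apply: cvgM; [exact: cvg_id|exact: edge_bump_cont].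
  have := sepE _ l r G_cont.
  by rewrite ek ek' !(K_liftE l r).
have height : edge_height c x = edge_height c' x'.
  have := sepE _ edge_height_left edge_height_right edge_height_cont.
  by rewrite ek ek' !(K_liftE edge_height_left edge_height_right).
have bump0 (e : edge) y : edge_dom e y -> edge_bump e e y = 0 -> y = edge_lo e \/ y = edge_hi e.
  move=> _; rewrite /edge_bump eqxx => /eqP.
  by rewrite mulf_eq0 !subr_eq0 => /orP[]/eqP ->; [left|right].
have [b0|b0] := eqVneq (edge_bump c c x) 0; last first.
  have cc' : c = c'.
    apply/eqP; apply: contraT => cc'; move: b0.
    by rewrite bump /edge_bump [c' == c]eq_sym (negbTE cc') eqxx.
  subst c'; rewrite ek ek'; apply: K_point_eq => //.
  have := xbump c; rewrite -(bump c) => /eqP.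
  rewrite -subr_eq0 -mulrBl mulf_eq0 (negbTE b0) orbF subr_eq0.
  by move/eqP.
have [b0'|b0'] := eqVneq (edge_bump c' c' x') 0; last first.
  have cc' : c = c'.
    by apply/eqP; apply: contraT => cc'; move: b0'; rewrite -bump /edge_bump (negbTE cc') eqxx.
  by subst c'; move: b0'; rewrite -bump b0 eqxx.
(* Each end of a two-letter edge is glued to an end of a letter edge, and [edge_height] takes
   distinct values at the latter. *)
have vertex (e : edge) y (hy : edge_dom e y) : edge_bump e e y = 0 ->
    exists a z (hz : edge_dom (inl a : edge) z),
    K_at e y hy = K_at (inl a) z hz /\ (z = edge_lo (inl a : edge) \/ z = edge_hi (inl a : edge)).
  move=> /(bump0 _ _ hy); case: e hy => [a|ab] hy ye; first by exists a, y, hy.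
  case: ye => /= ye; subst y.
    have hz : edge_dom (inl (val ab).1 : edge) (omega ord0 (val ab).1 - eps).
      exact: edge_dom_hi.
    by exists (val ab).1, (omega ord0 (val ab).1 - eps), hz; split; [rewrite -K_glue_left|right].
  have hz : edge_dom (inl (val ab).2 : edge) eps.
    exact: edge_dom_lo.
  by exists (val ab).2, eps, hz; split; [rewrite -K_glue_right|left].
have [a [z [hz [ez zend]]]] := vertex _ _ h b0.
have [a' [z' [hz' [ez' zend']]]] := vertex _ _ h' b0'.
move: height; rewrite -(K_liftE edge_height_left edge_height_right h).
rewrite -(K_liftE edge_height_left edge_height_right h') ez ez'.
rewrite !(K_liftE edge_height_left edge_height_right) ek ek' ez ez' => height.
suff [aa zz] : a = a' /\ z = z' by apply: K_point_eq => //; rewrite aa.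
case: zend zend' height {ez ez' hz hz'} => -> [] ->;
  rewrite !(edge_height_lo, edge_height_hi) => /eqP; rewrite eqr_nat => /eqP nn;
  try (exfalso; lia).
  have aa : a = a' by apply: val_inj => /=; lia.
  by rewrite aa.
have aa : a = a' by apply: val_inj => /=; lia.
by rewrite aa.
Qed.

End ComplexTopology.

(** * The projection *)

Section ProjectionTopology.
Context {R : realType} {d : nat} (phi : 'I_d -> seq 'I_d) (omega : 'rV[R]_d) (lambda : R).
Hypothesis omega_pos : forall a, 0 < omega ord0 a.
Hypothesis lambda_gt1 : 1 < lambda.

Local Notation TS := (tiling_space omega phi).
Local Notation agree := (agree omega).
Local Notation covers := (tile_covers omega).
Local Notation eps := (eps omega lambda).
Local Notation omin := (omin omega).
Local Notation K := (K phi omega lambda).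
Local Notation edge := (edge phi).
Local Notation edge_dom := (edge_dom omega lambda).
Local Notation two_letter := (two_letter phi).
Local Notation K_at c x h := (@K_point R d phi omega lambda c x h).
Local Notation proj := (@tiling_proj R d phi omega lambda).
Implicit Types (T : TS) (ab : two_letter).

Let ep (a : 'I_d) : 0 < eps := eps_gt0 omega_pos lambda_gt1 a.
Let ep2 a : 2 * eps < omega ord0 a := eps2_lt omega_pos lambda_gt1 a.

Lemma tiles_pos T i : tiles T (pos T i, lab T i).
Proof. by exists i. Qed.

Lemma tile_at0 T q : tiles T q -> covers q 0 -> q = (pos T 0, lab T 0).
Proof.
move=> Tq q0; apply: (geom_uniq (geom_tiles omega_pos T) Tq (tiles_pos T 0) q0).
by rewrite /tile_covers /= -pos_next// add0r pos0.
Qed.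

Definition at_letter T (a : 'I_d) (t : R) : Prop := tiles T (- t, a).

(** Index-free, so that it treats together the last two cases of p: the tile of index 0 is the right
    one when t >= 0 and the left one when t < 0. *)
Definition at_vertex T (a b : 'I_d) (t : R) : Prop :=
  tiles T (- t - omega ord0 a, a) /\ tiles T (- t, b).

Lemma at_vertexP T a b t : at_vertex T a b t -> - omin < t < omin ->
  0 <= t /\ [/\ t = offset T, b = lab T 0 & a = lab T (-1)] \/
  t < 0 /\ [/\ t = offset T - omega ord0 (lab T 0), a = lab T 0 & b = lab T 1].
Proof.
move=> [Ta Tb] /andP[t1 t2].
have ha := omin_le omega_pos a; have hb := omin_le omega_pos b.
have [t0|t0] := leP 0 t; [left|right].
  have [h1 h2] : (- t, b) = (pos T 0, lab T 0).
    by apply: tile_at0 => //; rewrite /tile_covers /=; apply/andP; split; lra.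
  split=> //; split=> //; first by rewrite /offset -h1 opprK.
  have hl := omin_le omega_pos (lab T (-1)).
  have e1 : pos T 0 = pos T (-1) + omega ord0 (lab T (-1)) by rewrite -pos_next// addNr.
  suff [] : (- t - omega ord0 a, a) = (pos T (-1), lab T (-1)) by [].
  apply: (geom_uniq (geom_tiles omega_pos T) Ta (tiles_pos T (-1)) (y := - t - omin / 2)).
    by rewrite /tile_covers /=; apply/andP; split; lra.
  by rewrite /tile_covers /=; apply/andP; split; lra.
have [h1 h2] : (- t - omega ord0 a, a) = (pos T 0, lab T 0).
  by apply: tile_at0 => //; rewrite /tile_covers /=; apply/andP; split; lra.
split=> //; split=> //; first by rewrite /offset -h1 -h2; lra.
have e1 : pos T 1 = pos T 0 + omega ord0 (lab T 0) by rewrite -pos_next// add0r.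
suff [] : (- t, b) = (pos T 1, lab T 1) by [].
have e2 : pos T 1 = - t by rewrite e1 -h1 -h2; lra.
apply: (geom_uniq (geom_tiles omega_pos T) Tb (tiles_pos T 1) (y := - t)).
  exact: (covers_start omega_pos (- t, b)).
by rewrite -e2; exact: (covers_start omega_pos (pos T 1, lab T 1)).
Qed.

Lemma at_letterP T a t : at_letter T a t -> 0 < t < omega ord0 a ->
  t = offset T /\ a = lab T 0.
Proof.
move=> Ta /andP[t1 t2]; have [h1 h2] : (- t, a) = (pos T 0, lab T 0).
  by apply: tile_at0 => //; rewrite /tile_covers /=; apply/andP; split; lra.
by rewrite /offset -h1 opprK.
Qed.

Lemma at_letter_offset T : at_letter T (lab T 0) (offset T).
Proof. by rewrite /at_letter /offset opprK; exact: tiles_pos. Qed.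

Lemma at_vertex_left T : at_vertex T (lab T (-1)) (lab T 0) (offset T).
Proof.
split; last exact: at_letter_offset.
have : pos T 0 = pos T (-1) + omega ord0 (lab T (-1)) by rewrite -pos_next// addNr.
by rewrite /offset opprK => ->; rewrite addrK; exact: tiles_pos.
Qed.

Lemma at_vertex_right T :
  at_vertex T (lab T 0) (lab T 1) (offset T - omega ord0 (lab T 0)).
Proof.
split; first by rewrite opprB addrAC subrr add0r; exact: at_letter_offset.
have : pos T 1 = pos T 0 + omega ord0 (lab T 0) by rewrite -pos_next// add0r.
rewrite /offset opprB opprK addrC => <-; exact: tiles_pos.
Qed.

Lemma tiling_proj_letter T a t (h : edge_dom (inl a : edge) t) :
  at_letter T a t -> proj T = K_at (inl a) t h.
Proof.
move=> Ta; have /andP[t1 t2] := h; have e0 := ep a.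
have [] := at_letterP Ta; first by apply/andP; split; lra.
move=> et ea; subst t a; rewrite /tiling_proj; case: pselect => // h'.
exact: K_point_eq.
Qed.

Lemma tiling_proj_vertex T ab t (h : edge_dom (inr ab) t) :
  at_vertex T (val ab).1 (val ab).2 t -> proj T = K_at (inr ab) t h.
Proof.
move=> Tab; have /andP[t1 t2] := h; have e0 := ep (lab T 0).
have hm := eps2_lt_omin omega_pos lambda_gt1 (lab T 0).
case: (at_vertexP Tab); first by apply/andP; split; lra.
  move=> [t0 [et eb ea]]; rewrite /tiling_proj; case: pselect => [h'|nmid].
    (* At this end [tiling_proj] uses its letter clause, and the gluing reconciles the two points;
       likewise at - eps below. *)
    have te : t = eps by move: h'; rewrite -et => /andP[? ?]; lra.
    have h2 : edge_dom (inr ab) eps by rewrite -te.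
    rewrite (K_point_eq h h2 erefl te).
    rewrite -(K_glue_right (edge_dom_lo phi omega_pos lambda_gt1 (val ab).2)).
    by apply: K_point_eq; [rewrite eb|rewrite -et].
  have left_end : 0 <= offset T <= eps by rewrite -et t0.
  case: pselect => // h'.
  apply: K_point_eq => //; congr inr; apply: val_inj => /=.
  by rewrite addNr -ea -eb -surjective_pairing.
move=> [t0 [et ea eb]]; rewrite /tiling_proj; case: pselect => [h'|nmid].
  have te : t = - eps by move: h'; rewrite et => /andP[? ?]; lra.
  have h2 : edge_dom (inr ab) (- eps) by rewrite -te.
  rewrite (K_point_eq h h2 erefl te).
  rewrite -(K_glue_left (edge_dom_hi phi omega_pos lambda_gt1 (val ab).1)).
  by apply: K_point_eq; [rewrite ea|rewrite ea; lra].
case: pselect => [h'|nleft].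
  by exfalso; have h2 := ep2 (lab T 0); move: h' => /andP[? ?]; lra.
apply: K_point_eq => //; congr inr; apply: val_inj => /=.
by rewrite add0r -ea -eb -surjective_pairing.
Qed.

Lemma tiling_proj_cases T :
  (exists a t, at_letter T a t /\ eps <= t <= omega ord0 a - eps) \/
  (exists ab t, at_vertex T (val ab).1 (val ab).2 t /\ - eps <= t <= eps).
Proof.
have /andP[b1 b2] := offset_itv T; have e0 := ep (lab T 0).
have [h1|h1] := leP eps (offset T); last first.
  right; exists (pair_at T (-1)), (offset T); split; last by apply/andP; split; lra.
  by rewrite /= addNr; exact: at_vertex_left.
have [h2|h2] := leP (offset T) (omega ord0 (lab T 0) - eps).
  left; exists (lab T 0), (offset T); split; last by rewrite h1 h2.
  exact: at_letter_offset.
right; exists (pair_at T 0), (offset T - omega ord0 (lab T 0)); split.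
  by rewrite /= add0r; exact: at_vertex_right.
by apply/andP; split; lra.
Qed.

End ProjectionTopology.

(** * The tiles determined by the projection, and its continuity *)

Section ProjectionContinuity.
Context {R : realType} {d : nat} (phi : 'I_d -> seq 'I_d) (omega : 'rV[R]_d) (lambda : R).
Hypothesis omega_pos : forall a, 0 < omega ord0 a.
Hypothesis lambda_gt1 : 1 < lambda.

Local Notation TS := (tiling_space omega phi).
Local Notation agree := (agree omega).
Local Notation covers := (tile_covers omega).
Local Notation eps := (eps omega lambda).
Local Notation omin := (omin omega).
Local Notation K := (K phi omega lambda).
Local Notation edge := (edge phi).
Local Notation edge_dom := (edge_dom omega lambda).
Local Notation two_letter := (two_letter phi).
Local Notation K_at c x h := (@K_point R d phi omega lambda c x h).
Local Notation proj := (@tiling_proj R d phi omega lambda).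
Implicit Types (T : TS) (ab : two_letter).

Let ep (a : 'I_d) : 0 < eps := eps_gt0 omega_pos lambda_gt1 a.
Let ep2 a : 2 * eps < omega ord0 a := eps2_lt omega_pos lambda_gt1 a.


Local Notation at_letter := (@at_letter R d phi omega).
Local Notation at_vertex := (@at_vertex R d phi omega).

(** The tiles near the origin that a point of K determines. At a glued end, the tile known only to
    the two-letter edge is at distance eps from the origin; cutting at eps / 2 discards it, so both
    descriptions agree. *)
Definition central_tiles (c : edge) (x : R) : set (@ltile R d) :=
  [set q | (match c with
            | inl a => q = (- x, a)
            | inr ab => q = (- x - omega ord0 (val ab).1, (val ab).1) \/ q = (- x, (val ab).2)
            end) /\ q.1 <= eps / 2 /\ - (eps / 2) <= q.1 + omega ord0 q.2].

Lemma central_tiles_left ab :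
  central_tiles (inl (val ab).1) (omega ord0 (val ab).1 - eps) = central_tiles (inr ab) (- eps).
Proof.
have e0 := ep (val ab).1.
apply/seteqP; split=> q [].
  by move=> -> h; split=> //; left; rewrite opprB opprK.
move=> [->|->] [/= h1 h2]; last by exfalso; lra.
by split=> //; congr pair; rewrite opprB opprK.
Qed.

Lemma central_tiles_right ab :
  central_tiles (inl (val ab).2) eps = central_tiles (inr ab) eps.
Proof.
have e0 := ep (val ab).1.
apply/seteqP; split=> q [].
  by move=> -> h; split=> //; right.
by move=> [->|->] [/= h1 h2]; split=> //; exfalso; lra.
Qed.

Lemma K_lift_proj T q : q.1 <= eps / 2 -> - (eps / 2) <= q.1 + omega ord0 q.2 ->
  K_lift central_tiles (proj T) q <-> tiles T q.
Proof.
move=> q1 q2; have e0 := ep q.2; have qp := omega_pos q.2.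
have gT := geom_tiles omega_pos T.
have [[a [t [Ta tab]]]|[ab [t [Tab tab]]]] := tiling_proj_cases omega_pos lambda_gt1 T.
  rewrite (tiling_proj_letter omega_pos lambda_gt1 tab Ta).
  rewrite (K_liftE central_tiles_left central_tiles_right).
  move: tab => /andP[t1 t2]; split=> [[-> _] //|Tq]; split=> //.
  (* A point of [q] in [-eps, eps / 2], an interval that the tile recorded by the projection
     covers. *)
  pose y := Num.max q.1 (- eps).
  have [y1 y2] : q.1 <= y /\ - eps <= y by rewrite !le_max !lexx orbT.
  have y3 : y < q.1 + omega ord0 q.2 by rewrite gt_max; apply/andP; split; lra.
  have y4 : y <= eps / 2 by rewrite ge_max q1 /=; lra.
  apply: (geom_uniq gT Tq Ta (y := y)).
    by rewrite /tile_covers y1 y3.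
  by rewrite /tile_covers /=; apply/andP; split; lra.
rewrite (tiling_proj_vertex omega_pos lambda_gt1 tab Tab).
rewrite (K_liftE central_tiles_left central_tiles_right).
move: tab => /andP[t1 t2]; move: Tab => [Ta Tb].
split=> [[[->|->] _] //|Tq]; split=> //.
pose y := Num.max q.1 (- eps).
have [y1 y2] : q.1 <= y /\ - eps <= y by rewrite !le_max !lexx orbT.
have y3 : y < q.1 + omega ord0 q.2 by rewrite gt_max; apply/andP; split; lra.
have y4 : y <= eps / 2 by rewrite ge_max q1 /=; lra.
have qy : covers q y by rewrite /tile_covers y1 y3.
have ha := ep2 (val ab).1; have hb := ep2 (val ab).2.
have [yt|ty] := ltP y (- t); [left|right].
  by apply: (geom_uniq gT Tq Ta qy); rewrite /tile_covers /=; apply/andP; split; lra.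
by apply: (geom_uniq gT Tq Tb qy); rewrite /tile_covers /=; apply/andP; split; lra.
Qed.

Lemma tiling_proj_agree T T' : proj T = proj T' -> agree (eps / 2) (tiles T) (tiles T').
Proof.
move=> TT' q q1 q2; split.
  by move/(K_lift_proj T q1 q2); rewrite TT' => /(K_lift_proj T' q1 q2).
by move/(K_lift_proj T' q1 q2); rewrite -TT' => /(K_lift_proj T q1 q2).
Qed.

(** Neither that x lies on the edge nor that it represents [k] is assumed, so the lemma applies to
    all candidate edges at once: off the edge, a small [del] leaves no x' to consider, and otherwise
    the inner implication is available. *)
Lemma K_at_nbhs (c : edge) (x : R) (k : K) (U : set K) : nbhs k U ->
  exists2 del, 0 < del & forall x' (h' : edge_dom c x'), `|x' - x| < del ->
    exists h : edge_dom c x, k = K_at c x h -> U (K_at c x' h').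
Proof.
move=> nU; have [h|nh] := pselect (edge_dom c x); last first.
  have [xl|lx] := ltP x (edge_lo omega lambda c).
    exists (edge_lo omega lambda c - x); first by rewrite subr_gt0.
    move=> x' h'; rewrite ltr_norml => /andP[h1 h2]; exfalso.
    by case: c h' xl h2 {nh h1} => [a|ab] /andP[/= ? ?]; lra.
  have [hx|xh] := ltP (edge_hi omega lambda c) x.
    exists (x - edge_hi omega lambda c); first by rewrite subr_gt0.
    move=> x' h'; rewrite ltr_norml => /andP[h1 h2]; exfalso.
    by case: c h' hx h1 {nh h2 lx} => [a|ab] /andP[/= ? ?]; lra.
  by exfalso; apply: nh; case: c lx xh => [a|ab] /= lx xh; rewrite lx xh.
have [ek|nk] := pselect (k = K_at c x h); last first.
  by exists 1 => // x' h' _; exists h.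
pose s : edge_dom c := SigSub (mem_set h).
pose Q := {eq_quot (glued_equiv phi omega lambda)}%qT.
have nk : nbhs (\pi_Q (existT _ c s : edges phi omega lambda) : K)%qT U by rewrite ek in nU.
have nq := @pi_continuous _ Q (existT _ c s : edges phi omega lambda) U nk.
have nV : nbhs s [set s' : edge_dom c |
    U (\pi_Q (existT _ c s' : edges phi omega lambda) : K)%qT] by exact: nq.
move: nV; rewrite nbhsE => -[_ [[W oW <-] Ws] WU].
have : nbhs x W by apply: open_nbhs_nbhs.
move=> /nbhs_ballP[del /= del0 delW]; exists del => // x' h' x'x.
exists h => _; apply: (WU (SigSub (mem_set h'))); apply: delW.
by rewrite /ball /= distrC.
Qed.

Lemma tiling_proj_continuous : continuous proj.
Proof.
move=> T U nU.
(* The three edges on which tilings close to [T] can project: the tile at the origin, and the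
   vertices at its two ends. *)
have [d1 d10 h1] := K_at_nbhs (inl (lab T 0)) (offset T) nU.
have [d2 d20 h2] := K_at_nbhs (inr (pair_at T (-1))) (offset T) nU.
have [d3 d30 h3] := K_at_nbhs (inr (pair_at T 0)) (offset T - omega ord0 (lab T 0)) nU.
have e0 := ep (lab T 0).
(* Tiles of [T'] within 2 eps of the origin, moved by less than eps / 2, remain within this
   radius. *)
pose B := 3 * eps + 1.
pose r := Num.min (Num.min d1 d2) (Num.min d3 (Num.min (eps / 2) B^-1)).
have B0 : 0 < B by rewrite /B; lra.
have r0 : 0 < r by rewrite !lt_min d10 d20 d30 invr_gt0 B0 divr_gt0.
have [rd1 rd2 rd3 re rB] : [/\ r <= d1, r <= d2, r <= d3, r <= eps / 2 & r <= B^-1].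
  by rewrite !ge_min !lexx !orbT.
have {}rB : B <= r^-1 by rewrite -[leLHS]invrK lef_pV2 ?posrE ?invr_gt0.
apply/(nbhs_tilingP omega_pos); exists r => // T' /(tiling_closeP omega_pos _ _ r0)[e er h].
have [n1 n2] : e < r /\ - r < e by move: er; rewrite ltr_norml => /andP[].
have hm := eps2_lt_omin omega_pos lambda_gt1 (lab T 0).
have TT' (a : 'I_d) (s : R) : tiles T' (- s, a) ->
    - s <= 2 * eps -> - (2 * eps) <= - s + omega ord0 a ->
    tiles T (- (s - e), a).
  rewrite /B in rB => T's s1 s2; have -> : - (s - e) = - s + e by lra.
  by apply: (iffRL (h (- s + e, a) _ _)) => /=; [lra|lra|apply/translateE; rewrite /= addrK].
rewrite /=.
have [[a [t [Ta tab]]]|[ab [t [Tab tab]]]] := tiling_proj_cases omega_pos lambda_gt1 T'.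
  have ha := ep2 a; have /andP[t1 t2] := tab.
  have Ta' : at_letter T a (t - e) by apply: TT' => //; lra.
  have [et ea] : t - e = offset T /\ a = lab T 0.
    by apply: (at_letterP omega_pos Ta'); apply/andP; split; lra.
  rewrite (tiling_proj_letter omega_pos lambda_gt1 tab Ta).
  subst a; have [|hd] := h1 t tab.
    by rewrite -et opprB addrC subrK; exact: lt_le_trans rd1.
  apply; apply: tiling_proj_letter => //; exact: at_letter_offset.
have ha := ep2 (val ab).1; have hb := ep2 (val ab).2; have /andP[t1 t2] := tab.
have Tab' : at_vertex T (val ab).1 (val ab).2 (t - e).
  case: Tab => Ta Tb; split; last by apply: TT' => //; lra.
  have -> : - (t - e) - omega ord0 (val ab).1 = - ((t + omega ord0 (val ab).1) - e) by lra.
  apply: TT'; rewrite ?opprD//; lra.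
rewrite (tiling_proj_vertex omega_pos lambda_gt1 tab Tab).
case: (at_vertexP omega_pos Tab').
- by apply/andP; split; lra.
- move=> [_ [et eb ea]].
  have eab : ab = pair_at T (-1).
    by apply: val_inj => /=; rewrite addNr -ea -eb -surjective_pairing.
  subst ab; have [|hd] := h2 t tab.
    by rewrite -et opprB addrC subrK; exact: lt_le_trans rd2.
  apply; apply: tiling_proj_vertex => //; rewrite -et; exact: Tab'.
move=> [_ [et ea eb]].
have eab : ab = pair_at T 0.
  by apply: val_inj => /=; rewrite add0r -ea -eb -surjective_pairing.
subst ab; have [|hd] := h3 t tab.
  by rewrite -et opprB addrC subrK; exact: lt_le_trans rd3.
apply; apply: tiling_proj_vertex => //; rewrite -et; exact: Tab'.
Qed.

End ProjectionContinuity.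

(** * Surjectivity of the projection *)

Section ProjectionSurjective.
Context {R : realType} {d : nat} (phi : 'I_d -> seq 'I_d) (omega : 'rV[R]_d) (lambda : R).
Hypothesis phi_primitive : primitive_subst phi.
Hypothesis omega_pos : forall a, 0 < omega ord0 a.
Hypothesis lambda_gt1 : 1 < lambda.
Hypothesis omega_eigenvector : omega *m transition_mx R phi = lambda *: omega.

(** Every allowed word occurs in [T0], and a translation brings an occurrence of the required letter
    or pair to the position prescribed by [k]. *)
Lemma tiling_proj_surj (T0 : tiling_space omega phi) (k : K phi omega lambda) :
  exists T : tiling_space omega phi, tiling_proj lambda T = k.
Proof.
have gT0 := geom_tiles omega_pos T0.
have place u z : lang phi u -> exists T : tiling_space omega phi, word_tiles omega u z `<=` tiles T.
  move=> /(lang_occurs phi_primitive omega_pos lambda_gt1 omega_eigenvector gT0)[y uy].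
  have [T TE] := geom_tiling omega_pos (geom_translate gT0 (z - y)).
  exists T; rewrite TE => q uq; apply/translateE/uy.
  by apply/word_tilesD; rewrite addrC subrK.
have [c [x [h ->]]] := K_pointP k; case: c h => [a|ab] h.
  have [|T uT] := place [:: a] (- x); first by exists 0%N, a; exact: infix_refl.
  by exists T; apply: tiling_proj_letter => //; apply: uT; left.
have [|T uT] := place [:: (val ab).1; (val ab).2] (- x - omega ord0 (val ab).1).
  by apply/allowedE; exact: set_mem (valP ab).
exists T; apply: tiling_proj_vertex => //; split; apply: uT; first by left.
by right; left; rewrite subrK.
Qed.

End ProjectionSurjective.

(** * The inverse limit *)

Lemma compact_inverse_continuous (X Y : topologicalType) (g : X -> Y) (h : Y -> X) :
  compact [set: X] -> hausdorff_space Y -> continuous g -> cancel g h -> cancel h g ->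
  continuous h.
Proof.
move=> Xc Yh gc gK hK; apply/continuous_closedP => A Ac.
have -> : h @^-1` A = g @` A.
  by apply/seteqP; split=> [y Ay|_ [x Ax <-]]; [exists (h y)|rewrite /= gK].
apply: compact_closed => //; apply: continuous_compact; first exact: continuous_subspaceT.
exact: subclosed_compact Xc _.
Qed.

Lemma ptws_continuous (X Y : topologicalType) (F : X -> {ptws nat -> Y}) :
  (forall n, continuous (fun x => F x n)) -> continuous F.
Proof.
move=> Fc x; apply/cvg_sup => n; move: x.
apply/(@continuousP _ (initial_topology (fun u : {ptws nat -> Y} => u n))) => A [B oB <-].
rewrite -[_ @^-1` _]/((fun x => F x n) @^-1` B).
by apply: open_comp => // x _; exact: Fc.
Qed.

Section InverseLimit.
Context {X : topologicalType} (f : X -> X).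

Lemma inv_lim_coord_continuous n :
  continuous (fun x : inv_lim f => (set_val x : {ptws nat -> X}) n).
Proof.
move=> x; apply: (@continuous_comp _ {ptws nat -> X} _ set_val (fun u : {ptws nat -> X} => u n)).
  exact: initial_continuous.
exact: (@function_spaces.proj_continuous nat (fun _ => X) n).
Qed.

Lemma inv_lim_hausdorff : hausdorff_space X -> hausdorff_space (inv_lim f).
Proof.
move=> Xh x y xy; apply: val_inj; apply/funext => n; apply: Xh => A B nA nB.
have [z [zA zB]] := xy _ _ (inv_lim_coord_continuous nA) (inv_lim_coord_continuous nB).
by exists ((set_val z : {ptws nat -> X}) n).
Qed.

End InverseLimit.

Theorem lemma2 (R : realType) (d : nat) (phi : 'I_d -> seq 'I_d)
    (omega : 'rV[R]_d) (lambda : R)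
    (phi_nonempty : forall a, phi a != [::])
    (phi_primitive : primitive_subst phi)
    (phi_aperiodic : aperiodic_subst phi)
    (lambda_PF : perron_frobenius (transition_mx R phi) lambda)
    (omega_pos : forall a, 0 < omega ord0 a)
    (omega_eigenvector : omega *m transition_mx R phi = lambda *: omega)
    (f : K phi omega lambda -> K phi omega lambda)
    (f_semiconj : forall T : tiling_space omega phi,
       f (tiling_proj lambda T) = tiling_proj lambda (inflation lambda T)) :
  homeomorphic (inv_lim f) (tiling_space omega phi).
Proof.
have lambda_gt1 : 1 < lambda.
  exact: eigen_gt1 omega_pos _ _ omega_eigenvector phi_primitive (aperiodic_card phi_aperiodic).
pose TS := tiling_space omega phi.
pose Phi : TS -> TS := inflation lambda.
pose p : TS -> K phi omega lambda := tiling_proj lambda.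
have [T0 T0aper] := aperiodic_tiling omega_pos phi_aperiodic.
have Phi_inj : injective Phi by exact: inflation_inj T0aper.
have Phi_surj T : exists S, Phi S = T by exact: inflation_surj.
have /choice[Psi PsiK] := Phi_surj.
have PhiK : cancel Phi Psi by move=> T; apply: Phi_inj; rewrite PsiK.
have TSc : compact [set: TS] := tiling_space_compact omega_pos.
have TSh : hausdorff_space TS := tiling_space_hausdorff omega_pos.
have Kh : hausdorff_space (K phi omega lambda) := K_hausdorff omega_pos lambda_gt1.
have Phi_cont : continuous Phi by exact: inflation_continuous.
have p_cont : continuous p by exact: tiling_proj_continuous.
have Psi_cont : continuous Psi := compact_inverse_continuous TSc TSh Phi_cont PhiK PsiK.
have Psin_cont n : continuous (iter n Psi).
  elim: n => [|n IH] T /=; first exact: cvg_id.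
  by apply: continuous_comp; [exact: IH|exact: Psi_cont].
pose h0 T : {ptws nat -> K phi omega lambda} := fun n => p (iter n Psi T).
have h0_cont : continuous h0.
  apply: ptws_continuous => n T; apply: continuous_comp; first exact: Psin_cont.
  exact: p_cont.
have h0_lim T : inv_lim f (h0 T) by move=> n; rewrite f_semiconj -/Phi /= PsiK.
pose h T : inv_lim f := SigSub (mem_set (h0_lim T)).
have h_cont : continuous h by apply: continuous_comp_initial; exact: h0_cont.
have iterK n : cancel (iter n Psi) (iter n Phi).
  by elim: n => // n IH T; rewrite [iter n.+1 Phi _]iterSr [iter n.+1 Psi _]iterS PsiK IH.
have iterPsiK n : cancel (iter n Phi) (iter n Psi).
  by elim: n => // n IH T; rewrite [iter n.+1 Psi _]iterSr [iter n.+1 Phi _]iterS PhiK IH.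
have h_inj T T' : h T = h T' -> T = T'.
  move=> /(congr1 set_val) hT; apply: (tiles_inj omega_pos).
  have e0 := eps_gt0 omega_pos lambda_gt1 (lab T 0).
  apply: (agree_eq omega_pos) => r r0.
  have [n /(_ n (leqnn n)) hn] := expr_unbounded lambda_gt1 (r / (eps omega lambda / 2)).
  exists (lambda ^+ n * (eps omega lambda / 2)).
    by rewrite -ler_pdivrMr// divr_gt0.
  have pn : p (iter n Psi T) = p (iter n Psi T') := congr1 (fun u => u n) hT.
  have := agree_iter_infl omega_pos lambda_gt1 omega_eigenvector (n := n)
    (tiling_proj_agree omega_pos lambda_gt1 pn).
  by rewrite -!(tiles_iter_inflation omega_pos lambda_gt1 omega_eigenvector)// -/Phi !iterK.
have h_surj x : exists T, h T = x.
  have /choice[S SP] n : exists S, p S = (set_val x : {ptws nat -> _}) n.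
    exact: (tiling_proj_surj phi_primitive omega_pos lambda_gt1 omega_eigenvector T0).
  have xf n : f ((set_val x : {ptws nat -> _}) n.+1) = (set_val x : {ptws nat -> _}) n.
    by have := set_mem (valP x); apply.
  have pPhi m k : p (iter m Phi (S (k + m)%N)) = (set_val x : {ptws nat -> _}) k.
    elim: m k => [|m IH] k /=; first by rewrite addn0 SP.
    have fp T : f (p T) = p (Phi T) := f_semiconj T.
    by rewrite -fp addnS -addSn IH xf.
  (* By [pPhi], the coordinates of [h (u n)] of index at most n are those of [x]; a cluster point of
     [u] therefore has all of them. *)
  pose u n := iter n Phi (S n).
  have [T [_ clT]] : [set: TS] `&` cluster (u @ \oo) !=set0 by apply: TSc; exists 0%N.
  exists T; apply: val_inj; apply/funext => k; apply/esym; apply: Kh => A B nA nB.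
  have nB' : nbhs T ((p \o iter k Psi) @^-1` B).
    by apply: (continuous_comp (Psin_cont k T) (p_cont _)).
  have tail : (u @ \oo) [set q | exists2 n, (k <= n)%N & q = u n].
    by exists k => // n kn; exists n.
  have [_ [[n kn ->] uB]] := clT _ _ tail nB'.
  have un : p (iter k Psi (u n)) = (set_val x : {ptws nat -> _}) k.
    rewrite -(pPhi (n - k)%N k) subnKC// /u -{1}(subnKC kn) iterD.
    by rewrite iterPsiK.
  exists ((set_val x : {ptws nat -> _}) k); split; first exact: nbhs_singleton.
  by rewrite -un.
have /choice[g hg] := h_surj.
have gh : cancel h g by move=> T; apply: h_inj; rewrite hg.
exists g, h; split=> //.
exact: compact_inverse_continuous TSc (inv_lim_hausdorff Kh) h_cont gh hg.
Qed.
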